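(* Let $\phi_1,\phi_2$ be real with $|\phi_2|<1$, $\phi_1+\phi_2<1$, $\phi_2-\phi_1<1$, let $\mu\in\mathbb R$ and $\sigma^2>0$, and let $(z_t)_{t\in\mathbb Z}$ be the stationary AR(2) process with mean $\mu$, $z_t-\mu=\phi_1(z_{t-1}-\mu)+\phi_2(z_{t-2}-\mu)+a_t$, where the $a_t$ are independent $N(0,\sigma^2)$ random variables. Let $\hat\phi_1,\hat\phi_2$ be the Burg estimators for the unknown mean case computed from $z_1,\dots,z_n$. Then, as $n\to\infty$, $$E(\hat\phi_1-\phi_1)=-\frac{\phi_2+\phi_1+1}{n}+o\!\left(\frac1n\right),\qquad E(\hat\phi_2-\phi_2)=-\frac{2+4\phi_2}{n}+o\!\left(\frac1n\right).$$
   Context: The AR(2) process is the (causal) stationary solution, so $a_t$ is independent of $z_s$ for $s<t$. Write $\overline z_n=\frac1n\sum_{t=1}^n z_t$ and, for non-negative integers $m,k,i$ with $\max(m,k)<i\le n$, $$\overline{\mathcal S}_{m,k,i}=\frac1n\sum_{t=i}^n(z_{t-m}-\overline z_n)(z_{t-k}-\overline z_n).$$ The Burg estimators for unknown mean are $$\hat\phi_2=1-\frac{CD^2-2ED^2}{CD^2+8F^2G-4FHD},\qquad \hat\phi_1=\frac{2F}{D}(1-\hat\phi_2),$$ where $C=\overline{\mathcal S}_{0,0,3}+\overline{\mathcal S}_{2,2,3}$, $D=\overline{\mathcal S}_{0,0,2}+\overline{\mathcal S}_{1,1,2}$, $E=\overline{\mathcal S}_{0,2,3}$, $F=\overline{\mathcal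 S}_{0,1,2}$, $G=\overline{\mathcal S}_{1,1,3}$, $H=\overline{\mathcal S}_{0,1,3}+\overline{\mathcal S}_{2,1,3}$. (The statistic $E$ in these formulas is not to be confused with the expectation operator $E(\cdot)$ in the claim.) *)

(* Defs.v *)
From HB Require Import structures.
From mathcomp Require Import all_boot all_order all_algebra finmap.
From mathcomp Require Import all_classical all_reals all_analysis.

Set Implicit Arguments.
Unset Strict Implicit.
Unset Printing Implicit Defensive.

Import Order.TTheory GRing.Theory Num.Theory.
Import numFieldNormedType.Exports.

Local Open Scope classical_set_scope.
Local Open Scope ring_scope.

Section probability_notions.
Context d (T : measurableType d) (R : realType) (P : probability T R).

Definition mutually_independent (a : int -> {RV P >-> R}) : Prop :=
  forall (J : {fset int}) (B : int -> set R),
    (forall t, measurable (B t)) ->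
    P (\bigcap_(t in [set` J]) (a t @^-1` B t)) =
    (\prod_(t <- J) P (a t @^-1` B t))%E.

(* Joint independence: [a t] is independent of the sigma-algebra generated by
   [z s], [s < t]; finite cylinders form a pi-system generating the latter. *)
Definition independent_of_past (a z : int -> {RV P >-> R}) : Prop :=
  forall (t : int) (J : {fset int}) (A : set R) (B : int -> set R),
    (forall s, s \in J -> s < t) ->
    measurable A -> (forall s, measurable (B s)) ->
    P ((a t @^-1` A) `&` \bigcap_(s in [set` J]) (z s @^-1` B s)) =
    (P (a t @^-1` A) * P (\bigcap_(s in [set` J]) (z s @^-1` B s)))%E.

(* Only measurable sets are compared: the values of the library's set functions
   elsewhere carry no meaning. *)
Definition has_normal_law (mean sd : R) (X : {RV P >-> R}) : Prop :=
  forall A : set R, measurable A -> distribution P X A = normal_prob mean sd A.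

(* Second-order stationarity. *)
Definition stationary_with_mean (mu : R) (z : int -> {RV P >-> R}) : Prop :=
  [/\ forall t, (z t : T -> R) \in Lfun P 2%:E,
      forall t, 'E_P[z t]%E = mu%:E &
      forall s t h, covariance P (z (s + h)) (z (t + h)) =
                    covariance P (z s) (z t)].

(* [sigma] is the standard deviation of the innovations. *)
Record gaussian_AR2 (phi1 phi2 mu sigma : R) (a z : int -> {RV P >-> R}) :
    Prop := {
  ar2_innovations_independent : mutually_independent a ;
  ar2_innovations_normal : forall t, has_normal_law 0 sigma (a t) ;
  ar2_equation : forall t w,
    z t w - mu = phi1 * (z (t - 1) w - mu) + phi2 * (z (t - 2) w - mu) + a t w ;
  ar2_stationary : stationary_with_mean mu z ;
  ar2_causal : independent_of_past a z }.

End probability_notions.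

(* The estimators are functions of a sample path [z], of which only
   [z 1], ..., [z n] are used.  Division by zero returns 0. *)
Section burg.
Context (R : realType) (z : int -> R) (n : nat).

Definition sample_mean : R := n%:R^-1 * \sum_(1 <= t < n.+1) z t%:Z.

Definition Sbar (m k i : nat) : R :=
  n%:R^-1 * \sum_(i <= t < n.+1)
    (z (t%:Z - m%:Z) - sample_mean) * (z (t%:Z - k%:Z) - sample_mean).

Definition burgC : R := Sbar 0 0 3 + Sbar 2 2 3.
Definition burgD : R := Sbar 0 0 2 + Sbar 1 1 2.
Definition burgE : R := Sbar 0 2 3.
Definition burgF : R := Sbar 0 1 2.
Definition burgG : R := Sbar 1 1 3.
Definition burgH : R := Sbar 0 1 3 + Sbar 2 1 3.

Definition burg_phi2 : R :=
  1 - (burgC * burgD ^+ 2 - 2 * burgE * burgD ^+ 2) /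
      (burgC * burgD ^+ 2 + 8 * burgF ^+ 2 * burgG
       - 4 * burgF * burgH * burgD).

Definition burg_phi1 : R := 2 * burgF / burgD * (1 - burg_phi2).

End burg.

(* Main.v *)
Require Import Defs.
From HB Require Import structures.
From mathcomp Require Import all_boot all_order all_algebra finmap.
From mathcomp Require Import all_classical all_reals all_analysis.
From mathcomp Require Import measurable_realfun.
From mathcomp Require Import ring lra zify.

Set Implicit Arguments.
Unset Strict Implicit.
Unset Printing Implicit Defensive.

Import Order.TTheory GRing.Theory Num.Theory.
Import numFieldNormedType.Exports.

Local Open Scope classical_set_scope.
Local Open Scope ring_scope.

(* The identity R = (N/d0)(1 - e + e^2) - R e^3, valid whenever R = N/Den and
   Den = d0 (1 + e), expands the error R of either estimator without any lower
   bound on the random denominator, because the Burg estimators are bounded.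
   Hence it suffices to know the sample autocovariances up to O(1/n) in all
   moments, and their means up to O(n^(-3/2)).
   Multiplying the AR(2) equation by x_{t-1}, x_{t-2} and squaring it, then
   summing over t, expresses the sample autocovariances linearly, up to end
   effects of order 1/n, through the averages A, U1, U2 of the martingale
   differences a_t^2 - s, a_t x_{t-1}, a_t x_{t-2}. Their second moments are
   exact: E U_i U_j = s gamma_{|i-j|}/n and E A U_i = 0; E A^2 is not needed,
   as N vanishes to leading order when U1 = U2 = 0. The mean correction contributes
   only -E(xbar^2) = -s / ((1 - phi1 - phi2)^2 n). *)

(** * Uniformly bounded moments *)

(** The hypotheses give the process only a finite second moment and stationary covariances, neither
    a joint law nor strict stationarity. Yet the expansion multiplies many random factors, and each
    Cauchy-Schwarz step doubles the moment order. So moments of all orders, uniform in t, come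
    first: a quadratic form contracted by two steps of the recursion passes them from the
    innovations to the process. Orders are counted in powers of n^(-1/2), and n^(-3/2) is already
    o(1/n). The first-order terms of the two numerators are 8 g0^2 (U1 - rho U2) and 8 g0^2 (U2 -
    rho U1), with mean exactly 0. Each bias is therefore the mean of N2/d0 - N1 D1/d0^2, in which
    every product of fluctuations has a factor U1 or U2, the rest being end effects and the mean
    correction. The parameters are traded for the partial autocorrelations rho = phi1/(1 - phi2) and
    phi2. They factor every determinant and variance that occurs, so the final identities are
    rational ones that [field] decides. *)

Section bounded_moments.
Context d (T : measurableType d) (R : realType) (P : probability T R).

(** The bound may depend on p but not on i. Asking for every p makes the class closed under
    products. The extended integral keeps the bound meaningful before integrability is known. *)
Definition bddmom (I : Type) (X : I -> T -> R) : Prop :=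
  (forall i, measurable_fun setT (X i)) /\
  forall p : nat, exists C : R, forall i,
    (\int[P]_w (`|X i w| ^+ p)%:E <= C%:E)%E.

Definition mom (f : T -> R) := bddmom (fun _ : unit => f).

Definition Ex (f : T -> R) : R := \int[P]_w f w.

Lemma measurable_normX (f : T -> R) p : measurable_fun setT f ->
  measurable_fun setT (fun w => `|f w| ^+ p).
Proof. by move=> mf; apply: measurable_funX; exact: measurableT_comp. Qed.

Lemma le_moment (f : T -> R) (g : T -> R) (C : R) p :
  measurable_fun setT f -> measurable_fun setT g ->
  (forall w, `|f w| ^+ p <= g w) -> (\int[P]_w (g w)%:E <= C%:E)%E ->
  (\int[P]_w (`|f w| ^+ p)%:E <= C%:E)%E.
Proof.
move=> mf mg fg; apply: le_trans.
apply: ge0_le_integral => //=.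
- by apply/measurable_EFinP; exact: measurable_normX.
- exact/measurable_EFinP.
- by move=> x _; rewrite lee_fin fg.
Qed.

Lemma bddmom_le (I : Type) (X Y : I -> T -> R) :
  (forall i, measurable_fun setT (Y i)) ->
  (forall i w, `|Y i w| <= `|X i w|) -> bddmom X -> bddmom Y.
Proof.
move=> mY YX [mX bX]; split=> // p; have [C hC] := bX p.
exists C => i; apply: le_moment (hC i) => //.
  exact: measurable_normX.
by move=> w; rewrite lerXn2r ?nnegrE.
Qed.

Lemma eq_bddmom (I : Type) (X Y : I -> T -> R) :
  (forall i w, X i w = Y i w) -> bddmom X -> bddmom Y.
Proof.
move=> XY; rewrite (_ : X = Y)//; apply/funext => i; apply/funext => w.
exact: XY.
Qed.

Lemma bddmom_reindex (I J : Type) (g : J -> I) (X : I -> T -> R) :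
  bddmom X -> bddmom (fun j => X (g j)).
Proof.
move=> [mX bX]; split=> // p; have [C hC] := bX p.
by exists C => j; exact: hC.
Qed.

Lemma bddmom_mom (I : Type) (X : I -> T -> R) i : bddmom X -> mom (X i).
Proof. exact: (bddmom_reindex (fun _ : unit => i)). Qed.

Lemma bddmom_bounded (I : Type) (X : I -> T -> R) (K : R) :
  (forall i, measurable_fun setT (X i)) ->
  (forall i w, `|X i w| <= K) -> bddmom X.
Proof.
move=> mX XK; split=> // p; exists (K ^+ p) => i.
apply: (@le_moment _ (cst (K ^+ p))) => //.
  by move=> w; rewrite lerXn2r ?nnegrE//; exact: le_trans (XK i w).
by have /= := integral_cst P measurableT (K ^+ p)%:E; rewrite probability_setT mule1 => ->.
Qed.

Lemma bddmom_cst (I : Type) (c : I -> R) (K : R) :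
  (forall i, `|c i| <= K) -> bddmom (fun i _ => c i).
Proof. by move=> cK; apply: (@bddmom_bounded _ _ K). Qed.

Lemma ge0_integral_le_add (f g : T -> R) (a b : R) :
  measurable_fun setT f -> measurable_fun setT g ->
  (forall w, 0 <= f w) -> (forall w, 0 <= g w) ->
  (\int[P]_w (f w)%:E <= a%:E)%E -> (\int[P]_w (g w)%:E <= b%:E)%E ->
  (\int[P]_w (f w + g w)%:E <= (a + b)%:E)%E.
Proof.
move=> mf mg f0 g0 fa gb.
under eq_integral do rewrite EFinD.
rewrite ge0_integralD//=.
- by rewrite EFinD leeD.
- by move=> x _; rewrite lee_fin.
- exact/measurable_EFinP.
- by move=> x _; rewrite lee_fin.
- exact/measurable_EFinP.
Qed.

Lemma ge0_integral_leZ (f : T -> R) (k a : R) :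
  measurable_fun setT f -> 0 <= k ->
  (forall w, 0 <= f w) ->
  (\int[P]_w (f w)%:E <= a%:E)%E ->
  (\int[P]_w (k * f w)%:E <= (k * a)%:E)%E.
Proof.
move=> mf k0 f0 fa.
under eq_integral do rewrite EFinM.
rewrite ge0_integralZl//=.
- by rewrite EFinM; apply: lee_wpmul2l; rewrite ?lee_fin.
- exact/measurable_EFinP.
- by move=> x _; rewrite lee_fin.
Qed.

(** The sum is at most twice its larger term. *)
Lemma ler_exprD2 (x y : R) p : 0 <= x -> 0 <= y ->
  (x + y) ^+ p <= 2 ^+ p * (x ^+ p + y ^+ p).
Proof.
wlog xy : x y / x <= y.
  move=> H x0 y0; have [|yx] := leP x y; first by move=> xy; exact: H.
  by rewrite addrC [x ^+ _ + _]addrC; apply: H => //; exact: ltW.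
move=> x0 y0; apply: (@le_trans _ _ ((2 * y) ^+ p)).
  by rewrite lerXn2r ?nnegrE ?addr_ge0 ?mulr_ge0//; lra.
by rewrite exprMn ler_wpM2l ?exprn_ge0// lerDr exprn_ge0.
Qed.

Lemma bddmomD (I : Type) (X Y : I -> T -> R) : bddmom X -> bddmom Y ->
  bddmom (fun i w => X i w + Y i w).
Proof.
move=> [mX bX] [mY bY]; split=> [i|p]; first exact: measurable_funD.
have [a ha] := bX p; have [b hb] := bY p.
exists (2 ^+ p * (a + b)) => i.
have mXp : measurable_fun setT (fun w => `|X i w| ^+ p).
  exact: measurable_normX.
have mYp : measurable_fun setT (fun w => `|Y i w| ^+ p).
  exact: measurable_normX.
apply: (@le_moment _ (fun w => 2 ^+ p * (`|X i w| ^+ p + `|Y i w| ^+ p))).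
- exact: measurable_funD.
- by apply: measurable_funM => //; exact: measurable_funD.
- move=> w; apply: le_trans (ler_exprD2 _ _ _) => //.
  by rewrite lerXn2r ?nnegrE ?addr_ge0// ler_normD.
- apply: ge0_integral_leZ; rewrite ?exprn_ge0//.
  + exact: measurable_funD.
  + by apply: ge0_integral_le_add => // w; rewrite exprn_ge0.
Qed.

(** [u * v <= u ^+ 2 + v ^+ 2] for the p-th powers of the two absolute values stands in for
    Cauchy-Schwarz; the price is moments of order 2p. *)
Lemma bddmomM (I : Type) (X Y : I -> T -> R) : bddmom X -> bddmom Y ->
  bddmom (fun i w => X i w * Y i w).
Proof.
move=> [mX bX] [mY bY]; split=> [i|p]; first exact: measurable_funM.
have [a ha] := bX (p + p)%N; have [b hb] := bY (p + p)%N.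
exists (a + b) => i.
have mXp : measurable_fun setT (fun w => `|X i w| ^+ (p + p)).
  exact: measurable_normX.
have mYp : measurable_fun setT (fun w => `|Y i w| ^+ (p + p)).
  exact: measurable_normX.
apply: (@le_moment _ (fun w => `|X i w| ^+ (p + p) + `|Y i w| ^+ (p + p))).
- exact: measurable_funM.
- exact: measurable_funD.
- move=> w; rewrite normrM exprMn !exprD.
  set u := _ ^+ p; set v := _ ^+ p.
  have : 0 <= (u - v) ^+ 2 by exact: sqr_ge0.
  have : 0 <= u ^+ 2 by exact: sqr_ge0.
  have : 0 <= v ^+ 2 by exact: sqr_ge0.
  nra.
- by apply: ge0_integral_le_add => // w; rewrite exprn_ge0.
Qed.

Lemma bddmomN (I : Type) (X : I -> T -> R) : bddmom X ->
  bddmom (fun i w => - X i w).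
Proof.
move=> bX; apply: (bddmom_le _ _ bX) => [i|i w]; last by rewrite normrN.
by apply: measurable_funN; case: bX.
Qed.

Lemma bddmomB (I : Type) (X Y : I -> T -> R) : bddmom X -> bddmom Y ->
  bddmom (fun i w => X i w - Y i w).
Proof. by move=> bX bY; apply: bddmomD => //; exact: bddmomN. Qed.

Lemma bddmom1 (I : Type) (c : R) : bddmom (fun (_ : I) _ => c).
Proof. exact: (@bddmom_cst _ _ `|c|). Qed.

Lemma bddmomZ (I : Type) (c : R) (X : I -> T -> R) : bddmom X ->
  bddmom (fun i w => c * X i w).
Proof. by apply: bddmomM; exact: bddmom1. Qed.

Lemma bddmomX (I : Type) (X : I -> T -> R) k : bddmom X ->
  bddmom (fun i w => X i w ^+ k).
Proof.
move=> bX; elim: k => [|k IH].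
  by apply: eq_bddmom (bddmom1 I 1) => i w; rewrite expr0.
by apply: eq_bddmom (bddmomM bX IH) => i w; rewrite exprS.
Qed.

Lemma bddmom_norm (I : Type) (X : I -> T -> R) : bddmom X ->
  bddmom (fun i w => `|X i w|).
Proof.
move=> bX; apply: (bddmom_le _ _ bX) => [i|i w]; last by rewrite normr_id.
by apply: measurableT_comp => //; case: bX.
Qed.

Lemma momD f g : mom f -> mom g -> mom (fun w => f w + g w).
Proof. exact: bddmomD. Qed.
Lemma momB f g : mom f -> mom g -> mom (fun w => f w - g w).
Proof. exact: bddmomB. Qed.
Lemma momM f g : mom f -> mom g -> mom (fun w => f w * g w).
Proof. exact: bddmomM. Qed.
Lemma momX f k : mom f -> mom (fun w => f w ^+ k).
Proof. exact: (@bddmomX unit (fun _ => f) k). Qed.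
Lemma momZ c f : mom f -> mom (fun w => c * f w).
Proof. exact: bddmomZ. Qed.
Lemma mom_cst c : mom (fun=> c). Proof. exact: bddmom1. Qed.

Lemma mom_sum (s : seq nat) (F : nat -> T -> R) :
  (forall t, mom (F t)) -> mom (fun w => \sum_(t <- s) F t w).
Proof.
move=> mF; elim: s => [|t s IH].
  by apply: eq_bddmom (mom_cst 0) => i w; rewrite big_nil.
by apply: eq_bddmom (momD (mF t) IH) => i w; rewrite big_cons.
Qed.

Lemma mom_integrable f : mom f -> P.-integrable setT (EFin \o f).
Proof.
move=> [mf bf]; have [C hC] := bf 1%N; apply/integrableP; split.
  by apply/measurable_EFinP; exact: mf tt.
by apply: le_lt_trans (hC tt) (ltry _).
Qed.

Lemma mom_measurable f : mom f -> measurable_fun setT f.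
Proof. by case=> mf _; exact: mf tt. Qed.

Lemma ExD f g : mom f -> mom g -> Ex (fun w => f w + g w) = Ex f + Ex g.
Proof.
by move=> mf mg; rewrite /Ex RintegralD//; exact: mom_integrable.
Qed.

Lemma ExB f g : mom f -> mom g -> Ex (fun w => f w - g w) = Ex f - Ex g.
Proof.
by move=> mf mg; rewrite /Ex RintegralB//; exact: mom_integrable.
Qed.

Lemma ExZ c f : mom f -> Ex (fun w => c * f w) = c * Ex f.
Proof. by move=> mf; rewrite /Ex RintegralZl//; exact: mom_integrable. Qed.

Lemma Ex_cst c : Ex (fun=> c) = c.
Proof. by rewrite /Ex Rintegral_cst//= probability_setT /= mulr1. Qed.

Lemma eq_Ex f g : (forall w, f w = g w) -> Ex f = Ex g.
Proof. by move=> fg; congr Ex; apply/funext. Qed.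

Lemma Ex_sum (s : seq nat) (F : nat -> T -> R) :
  (forall t, mom (F t)) ->
  Ex (fun w => \sum_(t <- s) F t w) = \sum_(t <- s) Ex (F t).
Proof.
move=> mF; elim: s => [|t s IH].
  by rewrite big_nil -[RHS]Ex_cst; apply: eq_Ex => w; rewrite big_nil.
rewrite big_cons -IH -ExD//; last exact: mom_sum.
by apply: eq_Ex => w; rewrite big_cons.
Qed.

Lemma le_Ex f g : mom f -> mom g -> (forall w, f w <= g w) -> Ex f <= Ex g.
Proof.
by move=> mf mg fg; apply: le_Rintegral => //; exact: mom_integrable.
Qed.

Lemma Ex_ge0 f : (forall w, 0 <= f w) -> 0 <= Ex f.
Proof. by move=> f0; apply: Rintegral_ge0. Qed.

Lemma integral_Ex f : mom f -> (\int[P]_w (f w)%:E)%E = (Ex f)%:E.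
Proof.
move=> mf; rewrite fineK//; apply: integrable_fin_num => //.
exact: mom_integrable.
Qed.

Lemma norm_Ex f : mom f -> `|Ex f| <= Ex (fun w => `|f w|).
Proof. by move=> mf; apply: le_normr_Rintegral => //; exact: mom_integrable. Qed.

Lemma mom_norm f : mom f -> mom (fun w => `|f w|).
Proof. exact: (@bddmom_norm unit (fun=> f)). Qed.

Lemma bddmom_Ex (I : Type) (X : I -> T -> R) : bddmom X ->
  exists C, forall i, `|Ex (X i)| <= C.
Proof.
move=> bX; have [_ /(_ 1%N) [C hC]] := bX; exists C => i.
have mX := bddmom_mom i bX.
apply: (le_trans (norm_Ex mX)); rewrite -lee_fin -integral_Ex; last exact: mom_norm.
exact: hC.
Qed.

(** From |x|^p <= 1 + x^(2p). Even powers carry no absolute value, so they can be expanded as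
    polynomials, as [psum_moment] does. *)
Lemma bddmom_evenP (I : Type) (X : I -> T -> R) :
  (forall i, mom (X i)) ->
  (forall k, exists C : R, forall i, Ex (fun w => X i w ^+ (2 * k)) <= C) ->
  bddmom X.
Proof.
move=> mX bX; split=> [i|p]; first by apply: mom_measurable.
have [C hC] := bX p; exists (1 + C) => i.
have mXi : mom (fun w => X i w ^+ (2 * p)).
  exact: (momX _ (mX i)).
apply: (@le_moment _ (fun w => 1 + X i w ^+ (2 * p))).
- exact: mom_measurable.
- by apply: measurable_funD => //; exact: mom_measurable.
- move=> w; rewrite exprM -real_normK ?num_real// -exprM mulnC exprM.
  set u := _ ^+ p; have : 0 <= (u - 1) ^+ 2 by exact: sqr_ge0.
  have : 0 <= u ^+ 2 by exact: sqr_ge0.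
  by rewrite !expr2; nra.
- rewrite integral_Ex; last exact: momD (mom_cst 1) mXi.
  by rewrite lee_fin ExD ?Ex_cst ?lerD2l//; exact: mom_cst.
Qed.

End bounded_moments.

(** * Independence of the past *)

Section independence.
Context d (T : measurableType d) (R : realType) (P : probability T R).

Section factorization.
Context d' (S : measurableType d') (X : {mfun T >-> R}) (V : {mfun T >-> S}).
Hypothesis XV : forall A B, measurable A -> measurable B ->
  P (X @^-1` A `&` V @^-1` B) = (P (X @^-1` A) * P (V @^-1` B))%E.
Variables (g : R -> R) (h : S -> R).
Hypotheses (mg : measurable_fun setT g) (mh : measurable_fun setT h).

Let W (w : T) : R * S := (X w, V w).
Let mW : measurable_fun setT W.
Proof. exact: measurable_fun_pair. Qed.
Let Wm : {mfun T >-> (R * S)%type} := HB.pack W (isMeasurableFun.Build _ _ _ _ _ mW).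

Let m1 : probability R R := distribution P X.
Let m2 : probability S R := distribution P V.
Let m' : probability (R * S)%type R := distribution P Wm.

Let prodE Z : measurable Z -> (m1 \x m2)%E Z = m' Z.
Proof.
apply: product_measure_unique => A B mA mB.
by rewrite /m' /m1 /m2 /distribution /pushforward /= -XV.
Qed.

Let f (z : R * S) : R := g z.1 * h z.2.

Let mf : measurable_fun setT f.
Proof.
by apply: measurable_funM; apply: measurableT_comp.
Qed.

Hypotheses (ig : P.-integrable setT (EFin \o (g \o X)))
  (ih : P.-integrable setT (EFin \o (h \o V))).

Let prod_int (k : R * S -> \bar R) :
  (\int[m1 \x m2]_z k z = \int[m']_z k z)%E.
Proof. by apply: eq_measure_integral => Z mZ _; exact: prodE. Qed.

Let ig' : m1.-integrable setT (EFin \o g).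
Proof.
apply/integrable_pushforward => //.
exact/measurable_EFinP.
Qed.

Let ih' : m2.-integrable setT (EFin \o h).
Proof.
apply/integrable_pushforward => //.
exact/measurable_EFinP.
Qed.

Let if' : (m1 \x m2)%E.-integrable setT (EFin \o f).
Proof.
apply/integrable12ltyP; first exact/measurable_EFinP.
have [_ gy] := integrableP _ _ _ ig'; have [_ hy] := integrableP _ _ _ ih'.
have inner x : (\int[m2]_y `|(EFin \o f) (x, y)| =
    `|g x|%:E * \int[m2]_y `|h y|%:E)%E.
  rewrite -ge0_integralZl//=; last first.
    by apply/measurable_EFinP; apply: measurableT_comp.
  by apply: eq_integral => y _; rewrite /f /= normrM EFinM.
under eq_integral do rewrite inner.
rewrite ge0_integralZr//=.
- apply: lte_mul_pinfty => //.
  + exact: integral_ge0.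
  + by rewrite ge0_fin_numE//; exact: integral_ge0.
- by apply/measurable_EFinP; apply: measurableT_comp.
- exact: integral_ge0.
Qed.

Lemma integrable_indepM :
  P.-integrable setT (EFin \o (fun w => g (X w) * h (V w))).
Proof.
apply/integrableP; split.
  by apply/measurable_EFinP; apply: measurable_funM; apply: measurableT_comp.
have [_] := integrableP _ _ _ if'; rewrite prod_int ge0_integral_distribution//.
by apply: measurableT_comp => //; exact/measurable_EFinP.
Qed.

(** The joint law of X and V agrees with the product of the marginals on rectangles, hence
    everywhere, and Fubini applies. The target of V is an arbitrary measurable space so that V can
    carry a whole sigma-algebra. *)
Lemma Ex_indepM_factor : Ex P (fun w => g (X w) * h (V w)) =
  Ex P (fun w => g (X w)) * Ex P (fun w => h (V w)).
Proof.
rewrite /Ex /Rintegral.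
have -> : (\int[P]_w (g (X w) * h (V w))%:E = \int[m']_z (EFin \o f) z)%E.
  rewrite integral_distribution//; first exact/measurable_EFinP.
  exact: integrable_indepM.
rewrite -prod_int -integral12_prod_meas1//.
have hE : (\int[m2]_y (h y)%:E = \int[P]_w (h (V w))%:E)%E.
  by rewrite integral_distribution//; exact/measurable_EFinP.
have gE : (\int[m1]_y (g y)%:E = \int[P]_w (g (X w))%:E)%E.
  by rewrite integral_distribution//; exact/measurable_EFinP.
rewrite -hE -gE -fineM; last 2 first.
- exact: integrable_fin_num.
- exact: integrable_fin_num.
congr fine; rewrite -[X in (_ * X)%E]fineK; last exact: integrable_fin_num.
rewrite -integralZr//; apply: eq_integral => x _.
rewrite fineK; last exact: integrable_fin_num.
by rewrite /= -integralZl.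
Qed.

End factorization.
End independence.

Section past.
Context d (T : measurableType d) (R : realType) (P : probability T R).
Variable z : int -> {RV P >-> R}.

Definition cylinder (t : int) : set (set T) :=
  [set C | exists (J : {fset int}) (B : int -> set R),
     [/\ forall s, s \in J -> s < t, forall s, measurable (B s) &
         C = \bigcap_(s in [set` J]) (z s @^-1` B s)]].

(** A copy of [T] with the sigma-algebra generated by the z_s, s < t: measurability with respect to
    the past becomes ordinary measurability on another type. *)
Definition past (t : int) := g_sigma_algebraType (cylinder t).

Definition pastm (t : int) (Y : T -> R) : Prop :=
  @measurable_fun _ _ (past t) R setT Y.

Lemma cylinder_measurable t : cylinder t `<=` measurable.
Proof.
move=> _ [J [B [_ mB ->]]]; apply: fin_bigcap_measurable => [|s _]; first exact: finite_fset.
exact: measurable_funPTI.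
Qed.

Lemma cylinderT t : cylinder t setT.
Proof.
exists fset0, (fun=> setT); split=> //.
by apply/seteqP; split=> // w _ s /=; rewrite inE.
Qed.

Lemma setI_closed_cylinder t : setI_closed (cylinder t).
Proof.
move=> _ _ [J1 [B1 [J1t mB1 ->]]] [J2 [B2 [J2t mB2 ->]]].
exists (J1 `|` J2)%fset, (fun s => (if s \in J1 then B1 s else setT) `&`
  (if s \in J2 then B2 s else setT)); split.
- by move=> s; rewrite inE => /orP[/J1t|/J2t].
- by move=> s; apply: measurableI; case: ifP.
- apply/seteqP; split=> w /=.
    move=> [w1 w2] s /= _; split.
      by case: ifPn => // sJ; exact: w1.
    by case: ifPn => // sJ; exact: w2.
  move=> h; split=> s /= sJ.
    by have [] := h s; rewrite /= ?inE sJ//.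
  by have [] := h s; rewrite /= ?inE sJ ?orbT//.
Qed.

Lemma past_measurable t (B : set T) : @measurable _ (past t) B -> measurable B.
Proof.
exact: smallest_sub (@sigma_algebra_measurable _ T) (@cylinder_measurable t) B.
Qed.

Lemma pastm_z t s : s < t -> pastm t (z s).
Proof.
move=> st _ B mB; rewrite setTI; apply: sub_sigma_algebra.
exists [fset s]%fset, (fun=> B); split=> //.
  by move=> u; rewrite inE => /eqP ->.
apply/seteqP; split=> w /=.
  by move=> Bw u /=; rewrite inE => /eqP ->.
by apply; rewrite /= inE.
Qed.

Lemma pastm_mono (t u : int) Y : t <= u -> pastm t Y -> pastm u Y.
Proof.
move=> tu mY _ B mB; have := mY measurableT B mB.
apply: smallest_sub; first exact: smallest_sigma_algebra.
move=> C [J [D [Jt mD ->]]]; apply: sub_gen_smallest.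
by exists J, D; split=> // s /Jt st; exact: lt_le_trans tu.
Qed.

Lemma pastmD t X Y : pastm t X -> pastm t Y -> pastm t (fun w => X w + Y w).
Proof. exact: (@measurable_funD _ (past t)). Qed.
Lemma pastmB t X Y : pastm t X -> pastm t Y -> pastm t (fun w => X w - Y w).
Proof. exact: (@measurable_funB _ (past t)). Qed.
Lemma pastmM t X Y : pastm t X -> pastm t Y -> pastm t (fun w => X w * Y w).
Proof. exact: (@measurable_funM _ (past t)). Qed.
Lemma pastmX t X k : pastm t X -> pastm t (fun w => X w ^+ k).
Proof. exact: (@measurable_funX _ (past t)). Qed.
Lemma pastm_cst t c : pastm t (fun=> c).
Proof. exact: (@measurable_cst _ _ (past t)). Qed.
Lemma pastmZ t c X : pastm t X -> pastm t (fun w => c * X w).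
Proof. by apply: pastmM; exact: pastm_cst. Qed.
Lemma eq_pastm t X Y : (forall w, X w = Y w) -> pastm t X -> pastm t Y.
Proof. by move=> XY; rewrite (_ : X = Y)//; exact/funext. Qed.

Lemma pastm_sum t (s : seq nat) (F : nat -> T -> R) :
  (forall u, u \in s -> pastm t (F u)) -> pastm t (fun w => \sum_(u <- s) F u w).
Proof.
elim: s => [|u s IH] mF.
  by refine (eq_pastm _ (@pastm_cst t 0)) => w; rewrite big_nil.
have mFu : pastm t (F u) by apply: mF; rewrite inE eqxx.
have mFs : pastm t (fun w => \sum_(v <- s) F v w).
  by apply: IH => v vs; apply: mF; rewrite inE vs orbT.
by refine (eq_pastm _ (pastmD mFu mFs)) => w; rewrite big_cons.
Qed.

Variable a : int -> {RV P >-> R}.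
Hypothesis az : independent_of_past a z.

(** As functions of B both sides are finite measures, P restricted to the event a_t in A and a
    multiple of P. They agree on the pi-system of cylinders. *)
Lemma past_independent t (A : set R) (B : set T) :
  measurable A -> @measurable _ (past t) B ->
  P (a t @^-1` A `&` B) = (P (a t @^-1` A) * P B)%E.
Proof.
move=> mA; have mC : measurable (a t @^-1` A) by exact: measurable_funPTI.
have r0 : 0 <= fine (P (a t @^-1` A)) by exact: fine_ge0.
rewrite -[X in (X * _)%E]fineK ?fin_num_measure//.
pose m1 := mrestr P mC; pose m2 := mscale (NngNum r0) P.
move=> mB; rewrite setIC; change (m1 B = m2 B).
apply: (@g_sigma_algebra_measure_unique _ R T (cylinder t) _ (fun=> setT)) mB.
- exact: cylinder_measurable.
- by move=> _; exact: cylinderT.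
- by rewrite bigcup_const.
- exact: setI_closed_cylinder.
- move=> _ [J [D [Jt mD ->]]]; rewrite /= /mrestr /mscale /= setIC az//.
  by rewrite fineK// fin_num_measure.
- move=> _; rewrite /m1 /= /mrestr setTI.
  by apply: le_lt_trans (probability_le1 P mC) _; rewrite ltry.
Qed.

Let idp t : T -> past t := id.
Let midp t : measurable_fun setT (idp t).
Proof. by move=> _ B mB; rewrite setTI; exact: (@past_measurable t). Qed.

Lemma Ex_past_indep t (g : R -> R) (Y : T -> R) :
  measurable_fun setT g -> pastm t Y ->
  mom P (g \o a t) -> mom P Y ->
  Ex P (fun w => g (a t w) * Y w) = Ex P (g \o a t) * Ex P Y.
Proof.
move=> mg mY ig iY.
(* The identity, seen as a random element of the past; [Y] is a measurable function of it. *)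
pose V : {mfun T >-> past t} := HB.pack (idp t) (isMeasurableFun.Build _ _ _ _ _ (@midp t)).
apply: (@Ex_indepM_factor _ _ _ _ _ _ (a t) V) => //.
- by move=> A B mA mB; exact: past_independent.
- exact: mom_integrable.
- exact: mom_integrable.
Qed.

End past.

(** * Moments of the innovations *)

Section normal_moments.
Context (R : realType).
Local Notation leb := (@lebesgue_measure R).

(** The Radon-Nikodym derivative and the explicit density have equal integrals over every measurable
    set, so they coincide almost everywhere. *)
Lemma ge0_integral_normal_prob (m s : R) (f : R -> \bar R) :
  measurable_fun setT f -> (forall x, (0 <= f x)%E) ->
  (\int[normal_prob m s]_x f x =
   \int[leb]_x (f x * (normal_pdf m s x)%:E))%E.
Proof.
move=> mf f0; have dom := normal_prob_dominates m s.
rewrite -(Radon_Nikodym_SigmaFinite.change_of_variables dom)//.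
have mpdf : measurable_fun setT (EFin \o normal_pdf m s).
  by apply/measurable_EFinP; exact: measurable_normal_pdf.
have mRN := measurable_int _ (Radon_Nikodym_SigmaFinite.f_integrable dom).
apply: ae_eq_integral => //.
- exact: emeasurable_funM.
- exact: emeasurable_funM.
- apply: ae_eqe_mul2l; apply: integral_ae_eq => //.
  + exact: Radon_Nikodym_SigmaFinite.f_integrable.
  + move=> E _ mE.
    by rewrite -(Radon_Nikodym_SigmaFinite.f_integral dom).
Qed.

(** Doubling the standard deviation releases a factor exp(-u) with u = 3 x^2 / (8 s^2), since 1/2 -
    1/8 = 3/8, and exp(-u) absorbs any power of x. *)
Lemma normal_pdf_powl (s : R) p : 0 < s -> exists C : R, forall x,
  `|x| ^+ p * normal_pdf 0 s x <= C * normal_pdf 0 (2 * s) x.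
Proof.
move=> s0; have s20 : 2 * s != 0 by rewrite mulf_neq0 ?gt_eqF.
(* From x^2 = (8 s^2 / 3) u and u^(p+1) <= (p+1)! exp(u). *)
pose K := (8 * s ^+ 2 / 3) ^+ p.+1 * (p.+1)`!%:R : R.
exists (normal_peak s / normal_peak (2 * s) * (1 + K)) => x.
rewrite !normal_pdfE ?gt_eqF ?mulr_gt0// /normal_fun subr0.
set u := 3 * x ^+ 2 / (8 * s ^+ 2).
have -> : - x ^+ 2 / (s ^+ 2 *+ 2) = - u + - x ^+ 2 / ((2 * s) ^+ 2 *+ 2).
  by rewrite /u; field; rewrite gt_eqF.
rewrite expRD.
set e := expR (- x ^+ 2 / _).
have pk : normal_peak (2 * s) != 0 by rewrite gt_eqF// normal_peak_gt0.
have -> : normal_peak s / normal_peak (2 * s) * (1 + K) * (normal_peak (2 * s) * e) =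
    normal_peak s * ((1 + K) * e).
  by move: pk; move: (normal_peak _) (normal_peak _) (1 + K) e => q r k f r0; field.
rewrite mulrCA ler_wpM2l ?normal_peak_ge0// mulrA ler_wpM2r ?expR_ge0//.
rewrite expRN ler_pdivrMr ?expR_gt0//.
have u0 : 0 <= u by rewrite /u divr_ge0// mulr_ge0// sqr_ge0.
have h1 : 1 <= expR u by rewrite -expR0 ler_expR.
have h2 : u ^+ p.+1 <= (p.+1)`!%:R * expR u.
  have := expR_ge1Dxn p u0; rewrite -ler_pdivrMl ?ltr0n ?fact_gt0// => h.
  by apply: le_trans h; rewrite mulrC lerDr.
have h3 : `|x| ^+ p <= 1 + (x ^+ 2) ^+ p.+1.
  rewrite -[x ^+ 2]real_normK ?num_real//.
  have [x1|/ltW x1] := leP `|x| 1.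
    apply: (@le_trans _ _ 1); first by rewrite exprn_ile1.
    by rewrite lerDl exprn_ge0// exprn_ge0.
  apply: (@le_trans _ _ (`|x| ^+ (2 * p.+1))); first by rewrite ler_weXn2l//; lia.
  by rewrite exprM lerDr.
have h4 : (x ^+ 2) ^+ p.+1 = (8 * s ^+ 2 / 3) ^+ p.+1 * u ^+ p.+1.
  by rewrite -exprMn; congr (_ ^+ _); rewrite /u; field; rewrite gt_eqF.
apply: (le_trans h3); rewrite h4 [leRHS]mulrDl [1 * _]mul1r lerD//.
by rewrite /K -[leRHS]mulrA ler_wpM2l// exprn_ge0// divr_ge0// mulr_ge0// sqr_ge0.
Qed.

Lemma normal_prob_moment (s : R) p : 0 < s -> exists C : R,
  (\int[normal_prob 0 s]_x (`|x| ^+ p)%:E <= C%:E)%E.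
Proof.
move=> s0; have [C hC] := normal_pdf_powl p s0; exists C.
rewrite ge0_integral_normal_prob; last 2 first.
- by apply/measurable_EFinP; apply: measurable_normX; exact: measurable_id.
- by move=> x; rewrite lee_fin exprn_ge0.
have C0 : 0 <= C.
  have := hC 1; rewrite normr1 expr1n mul1r => h.
  have s20 : 2 * s != 0 by rewrite mulf_neq0 ?gt_eqF.
  have : 0 <= C * normal_pdf 0 (2 * s) 1 by exact: le_trans (normal_pdf_ge0 _ _ _) h.
  rewrite pmulr_lge0// normal_pdfE// mulr_gt0 ?expR_gt0//.
  exact: normal_peak_gt0.
apply: (@le_trans _ _ (\int[leb]_x (C%:E * (normal_pdf 0 (2 * s) x)%:E))%E).
  apply: ge0_le_integral => //.
  - by move=> x _; rewrite -EFinM lee_fin mulr_ge0 ?exprn_ge0 ?normal_pdf_ge0.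
  - apply: emeasurable_funM; apply/measurable_EFinP.
      by apply: measurable_normX; exact: measurable_id.
    exact: measurable_normal_pdf.
  - apply: emeasurable_funM; apply/measurable_EFinP => //.
    exact: measurable_normal_pdf.
  - by move=> x _; rewrite -!EFinM lee_fin.
rewrite ge0_integralZl//.
- by rewrite integral_normal_pdf mule1.
- by apply/measurable_EFinP; exact: measurable_normal_pdf.
- by move=> x _; rewrite lee_fin normal_pdf_ge0.
Qed.

End normal_moments.

Section normal_variables.
Context d (T : measurableType d) (R : realType) (P : probability T R).

(* The library equips the reals with two (convertible) measurable structures;
   [normal_prob] lives on [measurableTypeR]. *)
Let toR (X : {RV P >-> R}) : {mfun T >-> measurableTypeR R} :=
  HB.pack (X : T -> measurableTypeR R)
    (isMeasurableFun.Build _ _ T (measurableTypeR R) X (measurable_funPT X)).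

Lemma ge0_integral_normal (s : R) (X : {RV P >-> R}) (g : R -> \bar R) :
  has_normal_law 0 s X -> measurable_fun setT g -> (forall x, (0 <= g x)%E) ->
  (\int[P]_w g (X w) = \int[normal_prob 0 s]_x g x)%E.
Proof.
move=> nX mg g0.
rewrite (eq_measure_integral (distribution P (toR X))); last first.
  by move=> A mA _; exact/esym/nX.
by rewrite ge0_integral_distribution.
Qed.

Lemma bddmom_normal (I : Type) (s : R) (a : I -> {RV P >-> R}) : 0 < s ->
  (forall t, has_normal_law 0 s (a t)) -> bddmom P (fun t => a t : T -> R).
Proof.
move=> s0 na; split=> // p; have [C hC] := normal_prob_moment p s0.
exists C => t; rewrite (ge0_integral_normal (g := fun x => (`|x| ^+ p)%:E) (na t))//.
  by apply/measurable_EFinP; apply: measurable_normX; exact: measurable_id.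
Qed.

(** All that is asked of the innovation variance is that it be common to all times and positive; it
    cancels from both biases. *)
Lemma Ex_normal_sqr (s : R) (X Y : {RV P >-> R}) :
  has_normal_law 0 s X -> has_normal_law 0 s Y ->
  Ex P (fun w => X w ^+ 2) = Ex P (fun w => Y w ^+ 2).
Proof.
move=> nX nY; rewrite /Ex /Rintegral; congr fine.
have m2 : measurable_fun setT (fun x : R => (x ^+ 2)%:E : \bar R).
  by apply/measurable_EFinP; apply: measurable_funX; exact: measurable_id.
have p2 (x : R) : (0 <= (x ^+ 2)%:E)%E by rewrite lee_fin sqr_ge0.
by rewrite (ge0_integral_normal nX m2 p2) (ge0_integral_normal nY m2 p2).
Qed.

(** Otherwise X = 0 almost surely, while the normal law is absolutely continuous and gives the point
    0 no mass. *)
Lemma Ex_normal_sqr_gt0 (s : R) (X : {RV P >-> R}) : mom P X ->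
  has_normal_law 0 s X -> 0 < Ex P (fun w => X w ^+ 2).
Proof.
move=> mX nX; rewrite lt_def Ex_ge0 ?andbT; last by move=> w; exact: sqr_ge0.
apply/eqP => E0.
have m2 : mom P (fun w => X w ^+ 2) by exact: momX.
have /ae_eq_integral_abs : (\int[P]_w `|(X w ^+ 2)%:E| = 0)%E.
  rewrite (eq_integral (fun w => (X w ^+ 2)%:E)); first by rewrite integral_Ex// E0.
  by move=> w _; rewrite gee0_abs// lee_fin sqr_ge0.
move=> /(_ measurableT) [].
  exact/measurable_EFinP/(mom_measurable m2).
move=> N [mN PN hN].
have P0 : P (X @^-1` [set 0]) = 0.
  have /= := nX [set 0] (measurable_set1 0); rewrite /distribution /pushforward => ->.
  have /null_content_dominatesP := normal_prob_dominates 0 s; apply => //.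
  exact: lebesgue_measure_set1.
have : P setT = 0%E.
  have m0 : measurable (X @^-1` [set 0]) by exact: measurable_funPTI.
  have sub : setT `<=` N `|` X @^-1` [set 0].
    move=> w _; have [Xw|Xw] := eqVneq (X w) 0; first by right.
    left; apply: hN => /= /(_ I) [/eqP]; rewrite expf_eq0/=.
    by rewrite (negbTE Xw).
  apply/eqP; rewrite -measure_le0; apply: (@le_trans _ _ (P N + P (X @^-1` [set 0%R]))%E).
    apply: le_trans (measureU2 P mN m0).
    by apply: le_measure; rewrite ?inE//; exact: measurableU.
  by rewrite PN P0 adde0.
by rewrite probability_setT => /eqP; rewrite onee_eq0.
Qed.

End normal_variables.

(** * Moments of a contracting recursion *)

Section contraction.
Context d (T : measurableType d) (R : realType) (P : probability T R).

(** Convexity keeps the contraction factor c for every power, where the cruder [ler_exprD2] would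
    multiply it by 2^p. The induction rests on (u - v)(u^p - v^p) >= 0. *)
Lemma convex_exprn (c u v : R) p : 0 <= c <= 1 -> 0 <= u -> 0 <= v ->
  (c * u + (1 - c) * v) ^+ p <= c * u ^+ p + (1 - c) * v ^+ p.
Proof.
move=> /andP[c0 c1] u0 v0; elim: p => [|p IH]; first by rewrite !expr0; lra.
have d0 : 0 <= 1 - c by rewrite subr_ge0.
have w0 : 0 <= c * u + (1 - c) * v by rewrite addr_ge0 ?mulr_ge0.
rewrite exprS; apply: (le_trans (ler_wpM2l w0 IH)).
have key : 0 <= (u - v) * (u ^+ p - v ^+ p).
  have [uv|vu] := leP u v.
    by rewrite mulr_le0// subr_le0// lerXn2r.
  by rewrite mulr_ge0// subr_ge0 ?lerXn2r// ltW.
have cd : 0 <= c * (1 - c) by rewrite mulr_ge0.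
rewrite !exprS; set a := u ^+ p in key *; set b := v ^+ p in key *.
by have := mulr_ge0 cd key; lra.
Qed.

Lemma expr_small (c M e : R) : 0 <= c < 1 -> 0 < e ->
  exists m : nat, c ^+ m * M < e.
Proof.
move=> /andP[c0 c1] e0.
have c1' : `|c| < 1 by rewrite ger0_norm.
have := @cvg_geometric R M c c1'.
move=> /cvgrPdist_lt /(_ e e0) [m _ /(_ m (leqnn m))].
rewrite /= sub0r normrN => h; exists m.
by apply: le_lt_trans h; rewrite /geometric /= mulrC ler_norm.
Qed.

Section family.
Variables (Y al : int -> T -> R) (c C1 : R).
Hypotheses (c01 : 0 <= c < 1) (Y0 : forall t w, 0 <= Y t w)
  (al0 : forall t w, 0 <= al t w) (bal : bddmom P al)
  (mY : forall t, measurable_fun setT (Y t))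
  (EY : forall t, (\int[P]_w (Y t w)%:E <= C1%:E)%E)
  (YE : forall t w, Y t w <= c * Y (t - 2) w + al t w).

(** The first m terms of the series of c^j al_(t-2j); the lag is 2 because the recursion contracts
    over two time steps. *)
Fixpoint geosum m t w :=
  if m is m'.+1 then c * geosum m' (t - 2) w + al t w else 0.

Let c0 : 0 <= c. Proof. by case/andP: c01. Qed.
Let c1 : c < 1. Proof. by case/andP: c01. Qed.
Let d0 : 0 < 1 - c. Proof. by rewrite subr_gt0. Qed.

Let C10 : 0 <= C1.
Proof.
rewrite -lee_fin; apply: le_trans (EY 0).
by apply: integral_ge0 => w _; rewrite lee_fin.
Qed.

Let geosum_ge0 m t w : 0 <= geosum m t w.
Proof. by elim: m t => //= m IH t; rewrite addr_ge0// mulr_ge0. Qed.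

Let geosum_bddmom m : bddmom P (geosum m).
Proof.
elim: m => [|m IH]; first exact: bddmom1.
apply: bddmomD => //; apply: bddmomZ.
exact: (bddmom_reindex (fun t => t - 2) IH).
Qed.

Let geosum_moment p : exists C : R, 0 <= C /\
  forall m t, Ex P (fun w => geosum m t w ^+ p.+1) <= C.
Proof.
have bb : bddmom P (fun t w => ((1 - c)^-1 * al t w) ^+ p.+1).
  by apply: bddmomX; exact: bddmomZ.
have [C hC] := bddmom_Ex bb.
have C0 : 0 <= C by exact: le_trans (hC 0).
exists C; split=> //; elim=> [|m IH] t.
  by rewrite (@eq_Ex _ _ _ P _ (fun=> 0)) ?Ex_cst// => w /=; rewrite expr0n.
have bm u : mom P (fun w => geosum m u w ^+ p.+1).
  exact: (bddmom_mom u (bddmomX _ (geosum_bddmom m))).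
have bm1 : mom P (fun w => geosum m.+1 t w ^+ p.+1).
  exact: (bddmom_mom t (bddmomX _ (geosum_bddmom m.+1))).
have bt := bddmom_mom t bb.
apply: (@le_trans _ _ (Ex P (fun w => c * geosum m (t - 2) w ^+ p.+1 +
   (1 - c) * ((1 - c)^-1 * al t w) ^+ p.+1))).
  apply: le_Ex => //.
    by apply: momD; exact: momZ.
  move=> w /=.
  (* This makes the recursion a convex combination of the previous sum and al/(1 - c), so the bound
     C reproduces itself: c C + (1 - c) C = C, for every m. *)
  have E : (1 - c) * ((1 - c)^-1 * al t w) = al t w.
    by rewrite mulrA divff ?mul1r ?gt_eqF.
  rewrite -[X in (_ + X) ^+ _]E.
  apply: convex_exprn => //; first by rewrite c0 ltW.
  by apply: mulr_ge0 => //; rewrite invr_ge0 ltW.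
rewrite ExD; [|exact: momZ|exact: momZ].
rewrite !ExZ//.
have := ler_wpM2l c0 (IH (t - 2)).
have := ler_wpM2l (ltW d0) (le_trans (ler_norm _) (hC t)).
lra.
Qed.

Let Y_geosum m t w : Y t w <= geosum m t w + c ^+ m * Y (t - (2 * m)%:Z) w.
Proof.
elim: m t => [|m IH] t; first by rewrite /= expr0 mul1r add0r muln0 subr0.
apply: (le_trans (YE t w)) => /=.
have := ler_wpM2l c0 (IH (t - 2)).
have -> : t - 2 - (2 * m)%:Z = t - (2 * m.+1)%:Z :> int by lia.
rewrite exprS; lra.
Qed.

Let trunc (K : R) t w := Num.min (Y t w) K.

Let mtrunc K t : measurable_fun setT (trunc K t).
Proof. by apply: measurable_minr. Qed.

(** By min(e, K)^(p+1) <= K^p e the remainder e = c^m Y enters linearly, so a first moment of Y is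
    enough. *)
Let trunc_le (K : R) m t w p : 1 <= K -> trunc K t w ^+ p.+1 <=
  2 ^+ p.+1 * (geosum m t w ^+ p.+1 + K ^+ p * (c ^+ m * Y (t - (2 * m)%:Z) w)).
Proof.
move=> K1; set e := c ^+ m * _; set B := geosum m t w.
have e0 : 0 <= e by rewrite mulr_ge0// exprn_ge0.
have B0 : 0 <= B by exact: geosum_ge0.
have K0 : 0 <= K by apply: le_trans K1.
have me0 : 0 <= Num.min e K by rewrite le_min e0.
have h : trunc K t w <= B + Num.min e K.
  rewrite /trunc; have := Y_geosum m t w; rewrite -/e -/B => YB.
  have [eK|Ke] := leP e K.
    by apply: le_trans YB; rewrite ge_min lexx.
  by rewrite ge_min; apply/orP; right; rewrite lerDr.
have t0 : 0 <= trunc K t w by rewrite /trunc le_min Y0.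
apply: (@le_trans _ _ ((B + Num.min e K) ^+ p.+1)).
  by rewrite lerXn2r ?nnegrE ?addr_ge0.
apply: (le_trans (ler_exprD2 _ B0 me0)).
rewrite ler_wpM2l ?exprn_ge0// lerD2l exprSr ler_pM ?exprn_ge0//.
  by rewrite lerXn2r ?nnegrE// ge_min lexx orbT.
by rewrite ge_min lexx.
Qed.

Let trunc_moment p : exists C : R, forall (K : R) t, 1 <= K ->
  (\int[P]_w (trunc K t w ^+ p.+1)%:E <= C%:E)%E.
Proof.
have [C [C0 hC]] := geosum_moment p; exists (2 ^+ p.+1 * C) => K t K1.
have K0 : 0 <= K by apply: le_trans K1.
apply/lee_addgt0Pr => e e0.
(* m may depend on K and e because the moment bound C of [geosum] holds for all m. *)
have [m hm] := expr_small (2 ^+ p.+1 * (K ^+ p * C1)) c01 e0.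
have mm : mom P (fun w => geosum m t w ^+ p.+1).
  exact: (bddmom_mom t (bddmomX _ (geosum_bddmom m))).
apply: (@le_trans _ _ (2 ^+ p.+1 * (C + K ^+ p * (c ^+ m * C1)))%:E); last first.
  rewrite -EFinD lee_fin mulrDr lerD2l ltW//.
  by rewrite [ltLHS](_ : _ = c ^+ m * (2 ^+ p.+1 * (K ^+ p * C1)))//; ring.
apply: (@le_trans _ _ (\int[P]_w (2 ^+ p.+1 * (geosum m t w ^+ p.+1 +
    K ^+ p * (c ^+ m * Y (t - (2 * m)%:Z) w)))%:E)%E).
  apply: ge0_le_integral => //.
  - by move=> w _; rewrite lee_fin exprn_ge0// /trunc le_min Y0.
  - by apply/measurable_EFinP; apply: measurable_funX.
  - apply/measurable_EFinP; apply: measurable_funM => //.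
    apply: measurable_funD; first exact: mom_measurable mm.
    by apply: measurable_funM => //; apply: measurable_funM.
  - by move=> w _; rewrite lee_fin; exact: trunc_le.
have mKY : measurable_fun setT
    (fun w => K ^+ p * (c ^+ m * Y (t - (2 * m)%:Z) w)).
  by apply: measurable_funM => //; apply: measurable_funM.
have KY0 w : 0 <= K ^+ p * (c ^+ m * Y (t - (2 * m)%:Z) w).
  by rewrite mulr_ge0 ?mulr_ge0 ?exprn_ge0.
apply: ge0_integral_leZ.
- by apply: measurable_funD => //; exact: mom_measurable mm.
- by rewrite exprn_ge0.
- by move=> w; rewrite addr_ge0// exprn_ge0.
apply: ge0_integral_le_add => //.
- exact: mom_measurable mm.
- by move=> w; rewrite exprn_ge0.
- by rewrite integral_Ex// lee_fin.
apply: ge0_integral_leZ.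
- exact: measurable_funM.
- by rewrite exprn_ge0.
- by move=> w; rewrite mulr_ge0 ?exprn_ge0.
by apply: ge0_integral_leZ => //; rewrite exprn_ge0.
Qed.

(* Only the first moment of [Y] is known to be finite. Iterating the recursion
   bounds the moments of min(Y, K) uniformly in K, since the remainder c^m Y
   vanishes in mean; then K tends to infinity. *)
Lemma contraction_bddmom : bddmom P Y.
Proof.
split=> // -[|p].
  exists 1 => t; under eq_integral do rewrite expr0.
  by have /= := integral_cst P measurableT (1 : R)%:E; rewrite probability_setT mule1 => ->.
have [C hC] := trunc_moment p; exists C => t.
(* Levels k+1 rather than k: [trunc_moment] requires a level of at least 1. *)
pose g (k : nat) (w : T) : \bar R := (trunc k.+1%:R t w ^+ p.+1)%:E.
have K0 (k : nat) w : 0 <= trunc k.+1%:R t w by rewrite /trunc le_min Y0 ler0n.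
have ndg w : {homo g^~ w : m n / (m <= n)%N >-> (m <= n)%E}.
  move=> m n mn; rewrite lee_fin lerXn2r ?nnegrE// /trunc.
  by rewrite le_min !ge_min lexx/= ler_nat ltnS mn orbT.
have -> : (\int[P]_w (`|Y t w| ^+ p.+1)%:E = \int[P]_w (limn (g^~ w)))%E.
  apply: eq_integral => w _; apply/esym/lim_near_cst => //.
  near=> k; rewrite /g /trunc min_l ?ger0_norm//.
  apply: ltW; apply: (lt_trans (archi_boundP (Y0 t w))).
  rewrite ltr_nat ltnS; near: k; exact: nbhs_infty_ge.
rewrite monotone_convergence//.
- apply: lime_le; last by apply: nearW => k; apply: hC; rewrite ler1n.
  apply: ereal_nondecreasing_is_cvgn => m n mn.
  apply: ge0_le_integral => //.
  + by move=> w _; rewrite lee_fin exprn_ge0.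
  + by apply/measurable_EFinP; apply: measurable_funX.
  + by apply/measurable_EFinP; apply: measurable_funX.
  + by move=> w _; exact: ndg.
- by move=> k; apply/measurable_EFinP; apply: measurable_funX.
- by move=> k w _; rewrite lee_fin exprn_ge0.
Unshelve. all: by end_near. Qed.

End family.
End contraction.

(** * Sums of martingale differences *)

Section martingale_sums.
Context d (T : measurableType d) (R : realType) (P : probability T R).
Variable z : int -> {RV P >-> R}.

(** A Taylor remainder with its factor y^2 in view. Passing from one exponent to the next multiplies
    the remainder by x + y and adds (m+2) x^(m+1) y^2. *)
Lemma expr_taylor2 m : exists C : R, 0 <= C /\ forall x y : R,
  `|(x + y) ^+ m.+2 - x ^+ m.+2 - m.+2%:R * x ^+ m.+1 * y| <=
  C * (y ^+ 2 * (`|x| + `|y|) ^+ m).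
Proof.
elim: m => [|m [C [C0 hC]]].
  exists 1; split=> // x y; rewrite expr1 expr0 mulr1 mul1r.
  rewrite [X in `|X|](_ : _ = y ^+ 2); last by ring.
  by rewrite ger0_norm ?sqr_ge0.
exists (C + m.+2%:R); split; first by rewrite addr_ge0.
move=> x y.
have -> : (x + y) ^+ m.+3 - x ^+ m.+3 - m.+3%:R * x ^+ m.+2 * y =
    (x + y) * ((x + y) ^+ m.+2 - x ^+ m.+2 - m.+2%:R * x ^+ m.+1 * y) +
    m.+2%:R * (x ^+ m.+1 * y ^+ 2).
  rewrite -[m.+3%:R]natr1 !exprS; set a := (x + y) ^+ m; set b := x ^+ m.
  by ring.
set E := (X in (x + y) * X) in hC *.
have xy0 : 0 <= `|x| + `|y| by rewrite addr_ge0.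
apply: (le_trans (ler_normD _ _)); rewrite [leRHS]mulrDl lerD//.
  rewrite normrM; apply: (@le_trans _ _ ((`|x| + `|y|) *
    (C * (y ^+ 2 * (`|x| + `|y|) ^+ m)))).
    by rewrite ler_pM// ?ler_normD// hC.
  by rewrite [(_ + _) ^+ m.+1]exprS le_eqVlt; apply/orP; left; apply/eqP; ring.
rewrite normrM ger0_norm// ler_wpM2l//.
rewrite normrM [X in _ * X <= _]ger0_norm ?sqr_ge0// mulrC ler_wpM2l ?sqr_ge0//.
by rewrite normrX lerXn2r ?nnegrE// lerDl.
Qed.

(** Compare u with N v. The weight 1/N on the first term is what n iterations can afford. *)
Lemma weighted_young (N u v : R) k : 0 < N -> 0 <= u -> 0 <= v ->
  v * u ^+ k <= N^-1 * u ^+ k.+1 + N ^+ k * v ^+ k.+1.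
Proof.
move=> N0 u0 v0; have [uv|vu] := leP u (N * v).
  apply: (@le_trans _ _ (N ^+ k * v ^+ k.+1)); last first.
    by rewrite lerDr mulr_ge0 ?exprn_ge0// invr_ge0 ltW.
  rewrite exprS mulrCA ler_wpM2l// -exprMn lerXn2r ?nnegrE//.
  by rewrite mulr_ge0// ltW.
apply: (@le_trans _ _ (N^-1 * u ^+ k.+1)); last first.
  by rewrite lerDl mulr_ge0 ?exprn_ge0// ltW.
rewrite exprS mulrA ler_wpM2r ?exprn_ge0// ler_pdivlMl//.
exact: ltW.
Qed.

Variable D : int -> T -> R.
(** Martingale differences without conditional expectations: [aD] is adaptedness, and [oD] says that
    D_t is orthogonal to every past variable having all moments. *)
Hypotheses (bD : bddmom P D) (aD : forall t, pastm z (t + 1) (D t))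
  (oD : forall t Y, pastm z t Y -> mom P Y ->
     Ex P (fun w => D t w * Y w) = 0).

(** m counts the terms; time 3 is the first whose two lags lie in the sample. *)
Definition psum (F : int -> T -> R) m w : R :=
  \sum_(3 <= t < m.+3) F t%:Z w.

Lemma psum0 F w : psum F 0 w = 0.
Proof. by rewrite /psum big_geq. Qed.

Lemma psumS F m w : psum F m.+1 w = psum F m w + F m.+3%:Z w.
Proof. by rewrite /psum big_nat_recr. Qed.

Lemma psum_mom F m : bddmom P F -> mom P (psum F m).
Proof. by move=> bF; apply: mom_sum => t; exact: (bddmom_mom _ bF). Qed.

Lemma psum_past F m : (forall t, pastm z (t + 1) (F t)) ->
  pastm z m.+3%:Z (psum F m).
Proof.
move=> aF; apply: pastm_sum => u; rewrite mem_index_iota => /andP[_ um].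
by apply: (pastm_mono _ (aF _)); lia.
Qed.

(* Conditioning on the past removes the linear term of (M + D)^(2k); by Young's
   inequality the rest costs a factor 1 + K/n and a term of order n^(k-1), and n
   such steps are harmless. *)
Lemma psum_moment k : exists C : R, forall (m n : nat), (m <= n)%N -> (0 < n)%N ->
  Ex P (fun w => psum D m w ^+ (2 * k)) <= C * n%:R ^+ k.
Proof.
case: k => [|k].
  exists 1 => m n _ _; rewrite muln0 expr0 mulr1.
  by rewrite (@eq_Ex _ _ _ P _ (fun=> 1)) ?Ex_cst// => w; rewrite expr0.
have [C [C0 hC]] := expr_taylor2 (2 * k).
have bDk : bddmom P (fun t w => D t w ^+ (2 * k.+1)) by exact: bddmomX.
have [B hB] := bddmom_Ex bDk.
have B0 : 0 <= B by exact: le_trans (hB 0).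
pose K := C * 2 ^+ (2 * k).
have K0 : 0 <= K by rewrite mulr_ge0 ?exprn_ge0.
exists (expR K * (K * 2 * B)) => m n mn n0.
have N0 : 0 < n%:R :> R by rewrite ltr0n.
have N1 : 1 <= n%:R :> R by rewrite ler1n.
pose u j := Ex P (fun w => psum D j w ^+ (2 * k.+1)).
have rec j : u j.+1 <= (1 + K / n%:R) * u j + K * 2 * B * n%:R ^+ k.
  have mM : mom P (psum D j) by exact: psum_mom.
  have mD : mom P (D j.+3%:Z) by exact: (bddmom_mom _ bD).
  have mMk := momX (2 * k.+1) mM.
  have mDk := momX (2 * k.+1) mD.
  have mMD : mom P (fun w => D j.+3%:Z w * psum D j w ^+ (2 * k).+1).
    by apply: momM => //; exact: momX.
  apply: (@le_trans _ _ (Ex P (fun w => (1 + K / n%:R) * psum D j w ^+ (2 * k.+1) +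
    ((2 * k).+2%:R * (D j.+3%:Z w * psum D j w ^+ (2 * k).+1) +
     K * 2 * n%:R ^+ k * D j.+3%:Z w ^+ (2 * k.+1))))).
    apply: le_Ex.
    - exact: (momX _ (psum_mom _ bD)).
    - by apply: momD; [exact: momZ|apply: momD; exact: momZ].
    move=> w; rewrite psumS.
    set x := psum D j w; set y := D _ w.
    have e2 : (2 * k.+1 = (2 * k).+2)%N by lia.
    have := le_trans (ler_norm _) (hC x y); rewrite e2.
    have h1 : (`|x| + `|y|) ^+ (2 * k) <= 2 ^+ (2 * k) * (x ^+ (2 * k) + y ^+ (2 * k)).
      apply: (le_trans (ler_exprD2 _ _ _)) => //.
      by rewrite !exprM !real_normK ?num_real.
    have h2 : y ^+ 2 * (x ^+ (2 * k) + y ^+ (2 * k)) <=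
        n%:R^-1 * x ^+ (2 * k).+2 + 2 * n%:R ^+ k * y ^+ (2 * k).+2.
      rewrite -!e2 mulrDr [y ^+ 2 * y ^+ _]mulrC -[y ^+ (2 * k) * _]exprD addn2 -e2 !exprM.
      have := weighted_young k N0 (sqr_ge0 x) (sqr_ge0 y).
      have : y ^+ 2 ^+ k.+1 <= n%:R ^+ k * y ^+ 2 ^+ k.+1.
        have n1 : 1 <= n%:R ^+ k :> R by exact: exprn_ege1.
        by rewrite ler_peMl// exprn_ge0// sqr_ge0.
      set a := y ^+ 2 ^+ _; set b := y ^+ 2 * _; set c := _ * x ^+ 2 ^+ _.
      by set dd := n%:R ^+ k; lra.
    have h3 : C * (y ^+ 2 * (`|x| + `|y|) ^+ (2 * k)) <=
        K * (n%:R^-1 * x ^+ (2 * k).+2 + 2 * n%:R ^+ k * y ^+ (2 * k).+2).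
      rewrite /K -mulrA ler_wpM2l//.
      apply: (@le_trans _ _ (2 ^+ (2 * k) * (y ^+ 2 * (x ^+ (2 * k) + y ^+ (2 * k))))).
        by rewrite mulrCA ler_wpM2l ?sqr_ge0.
      by rewrite ler_wpM2l// exprn_ge0.
    set X := x ^+ (2 * k).+2 in h3 *; set Y := y ^+ (2 * k).+2 in h3 *.
    set V := x ^+ (2 * k).+1; set Z := (x + y) ^+ _.
    set W := C * _ in h3 *; set NN := n%:R^-1 in h3 *; set nk := n%:R ^+ k in h3 *.
    set q := (2 * k).+2%:R.
    by lra.
  rewrite ExD; [|exact: momZ|by apply: momD; exact: momZ].
  rewrite ExD; [|exact: momZ|exact: momZ].
  rewrite !ExZ// oD; last 2 first.
  - by apply: pastmX; apply: psum_past.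
  - exact: momX.
  rewrite mulr0 add0r lerD2l.
  have := le_trans (ler_norm _) (hB j.+3%:Z).
  rewrite [X in _ -> _ <= X](_ : _ = K * 2 * n%:R ^+ k * B); last by ring.
  by move=> h; rewrite ler_wpM2l// !mulr_ge0// exprn_ge0.
have q0 : 0 <= K / n%:R by rewrite divr_ge0.
have bnd j : u j <= (1 + K / n%:R) ^+ j * (j%:R * (K * 2 * B * n%:R ^+ k)).
  elim: j => [|j IH].
    rewrite /u (@eq_Ex _ _ _ P _ (fun=> 0)) ?Ex_cst ?mul0r ?mulr0//.
    by move=> w; rewrite psum0 expr0n.
  have q1 : 0 <= 1 + K / n%:R by rewrite addr_ge0.
  have := ler_wpM2l q1 IH; have := rec j.
  have : 1 <= (1 + K / n%:R) ^+ j.+1 by rewrite exprn_ege1// lerDl.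
  have cc : 0 <= K * 2 * B * n%:R ^+ k by rewrite !mulr_ge0// exprn_ge0.
  rewrite -[j.+1%:R]natr1 exprS.
  set c := K * 2 * B * _ in cc *; set q := 1 + _; set Q := q ^+ j.
  move=> h1 h2 h3; apply: (le_trans h2).
  have := ler_wpM2r cc h1; lra.
apply: (le_trans (bnd m)).
have e1 : (1 + K / n%:R) ^+ m <= expR K.
  apply: (@le_trans _ _ ((1 + K / n%:R) ^+ n)); first by rewrite ler_weXn2l// lerDl.
  apply: (@le_trans _ _ (expR (K / n%:R) ^+ n)).
    by rewrite lerXn2r ?nnegrE ?expR_ge0 ?addr_ge0// expR_ge1Dx.
  by rewrite -expRM_natl mulrC divfK// gt_eqF.
rewrite -[leRHS]mulrA ler_pM//.
- by rewrite exprn_ge0// addr_ge0.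
- by rewrite !mulr_ge0// exprn_ge0.
rewrite exprS [leLHS]mulrCA ler_wpM2l ?mulr_ge0//.
by rewrite ler_wpM2r ?exprn_ge0// ler_nat.
Qed.

(** In an off-diagonal product the later factor is orthogonal to the earlier one, so only the m
    diagonal terms remain. *)
Lemma psum_cross (D' : int -> T -> R) (c : R) m :
  bddmom P D' -> (forall t, pastm z (t + 1) (D' t)) ->
  (forall t Y, pastm z t Y -> mom P Y -> Ex P (fun w => D' t w * Y w) = 0) ->
  (forall t, Ex P (fun w => D t w * D' t w) = c) ->
  Ex P (fun w => psum D m w * psum D' m w) = m%:R * c.
Proof.
move=> bD' aD' oD' cD; elim: m => [|m IH].
  rewrite mul0r -(Ex_cst P 0); apply: eq_Ex => w; by rewrite psum0 mul0r.
have mM := psum_mom m bD; have mM' := psum_mom m bD'.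
have mD := bddmom_mom m.+3%:Z bD; have mD' := bddmom_mom m.+3%:Z bD'.
rewrite (@eq_Ex _ _ _ P _ (fun w => psum D m w * psum D' m w +
  (D' m.+3%:Z w * psum D m w + (D m.+3%:Z w * psum D' m w +
   D m.+3%:Z w * D' m.+3%:Z w)))); last first.
  by move=> w; rewrite !psumS; ring.
rewrite !ExD; try by do ?apply: momD; apply: momM.
rewrite IH cD oD' ?oD//; [|exact: psum_past|exact: psum_past].
by rewrite -[m.+1%:R]natr1; ring.
Qed.

Lemma Ex_psum m : Ex P (psum D m) = 0.
Proof.
rewrite /psum Ex_sum; last by move=> t; exact: (bddmom_mom _ bD).
rewrite big1// => t _.
rewrite -[RHS](oD (@pastm_cst _ _ _ _ z t%:Z 1) (mom_cst P 1)).
by apply: eq_Ex => w; rewrite mulr1.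
Qed.

End martingale_sums.

(** * Stochastic expansions *)

Section expansions.
Context d (T : measurableType d) (R : realType) (P : probability T R).
Implicit Types X Y : nat -> T -> R.

Definition rt (n : nat) : R := Num.sqrt n.+3%:R.

Lemma rt_ge1 n : 1 <= rt n.
Proof. by rewrite -[1](@sqrtr1 R) ler_sqrt// ler1n. Qed.

Lemma rt_gt0 n : 0 < rt n.
Proof. exact: lt_le_trans (rt_ge1 n). Qed.

Lemma rt_ge0 n : 0 <= rt n.
Proof. exact: ltW (rt_gt0 n). Qed.

Lemma rt_neq0 n : rt n != 0.
Proof. by rewrite gt_eqF// rt_gt0. Qed.

Lemma rt_sqr n : rt n ^+ 2 = n.+3%:R.
Proof. by rewrite sqr_sqrtr. Qed.

(* X_n = O(n^(-k/2)) in every moment; the shift to [n.+3] skips the sample sizes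
   for which the estimators are degenerate. *)
Definition momO (k : nat) X := bddmom P (fun n w => rt n ^+ k * X n.+3 w).

Lemma eq_momO k X Y : (forall n w, X n.+3 w = Y n.+3 w) -> momO k X -> momO k Y.
Proof. by move=> XY; apply: eq_bddmom => n w; rewrite XY. Qed.

Lemma momOD k X Y : momO k X -> momO k Y -> momO k (fun n w => X n w + Y n w).
Proof.
move=> bX bY; apply: eq_bddmom (bddmomD bX bY) => n w; by rewrite mulrDr.
Qed.

Lemma momOM j k X Y : momO j X -> momO k Y ->
  momO (j + k) (fun n w => X n w * Y n w).
Proof.
move=> bX bY; apply: eq_bddmom (bddmomM bX bY) => n w.
by rewrite exprD; ring.
Qed.

Lemma momON k X : momO k X -> momO k (fun n w => - X n w).
Proof. by move=> bX; apply: eq_bddmom (bddmomN bX) => n w; rewrite mulrN. Qed.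

Lemma momOB k X Y : momO k X -> momO k Y -> momO k (fun n w => X n w - Y n w).
Proof. by move=> bX bY; apply: momOD => //; exact: momON. Qed.

Lemma momO_le j k X : (j <= k)%N -> momO k X -> momO j X.
Proof.
move=> jk bX; rewrite -(subnK jk) in bX.
have bi : bddmom P (fun n (_ : T) => (rt n)^-1 ^+ (k - j)).
  apply: (@bddmom_cst _ _ _ _ _ _ 1) => n.
  have i0 : 0 <= (rt n)^-1 by rewrite invr_ge0 rt_ge0.
  rewrite ger0_norm ?exprn_ge0// exprn_ile1// invf_le1 ?rt_gt0//.
  exact: rt_ge1.
apply: eq_bddmom (bddmomM bi bX) => n w.
rewrite exprD mulrA mulrA -exprMn mulVf ?rt_neq0// expr1n mul1r.
by [].
Qed.

Lemma momO_cst c : momO 0 (fun _ _ => c).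
Proof.
by apply: eq_bddmom (bddmom1 P nat c) => n w; rewrite expr0 mul1r.
Qed.

Lemma momOZ k c X : momO k X -> momO k (fun n w => c * X n w).
Proof. by move=> bX; apply: (momOM (momO_cst c) bX). Qed.

Lemma momO_det k (c : nat -> R) (K : R) :
  (forall n, rt n ^+ k * `|c n.+3| <= K) -> momO k (fun n _ => c n).
Proof.
move=> cK; apply: (@bddmom_cst _ _ _ _ _ _ K) => n.
by rewrite normrM ger0_norm// exprn_ge0 ?rt_ge0.
Qed.

Lemma momO2_inv (F : nat -> T -> R) : bddmom P F ->
  momO 2 (fun n w => n%:R^-1 * F n w).
Proof.
move=> bF; apply: eq_bddmom (bddmom_reindex (fun n => n.+3) bF) => n w.
by rewrite rt_sqr mulrA mulfV ?mul1r// pnatr_eq0.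
Qed.

Lemma momO_mom k X n : momO k X -> mom P (X n.+3).
Proof.
move=> bX; have := bddmom_mom n (momO_le (leq0n k) bX).
by apply: eq_bddmom => _ w; rewrite expr0 mul1r.
Qed.

Lemma momO_Ex k X : momO k X ->
  exists K, forall n, `|Ex P (X n.+3)| <= K / rt n ^+ k.
Proof.
move=> bX; have [K hK] := bddmom_Ex bX; exists K => n.
have := hK n; rewrite ExZ; last exact: momO_mom bX.
rewrite normrM ger0_norm ?exprn_ge0 ?rt_ge0// mulrC.
by rewrite ler_pdivlMr// exprn_gt0// rt_gt0.
Qed.

Definition meanO X (c : R) := (forall n, mom P (X n.+3)) /\
  exists K, forall n, `|Ex P (X n.+3) - c / n.+3%:R| <= K / rt n ^+ 3.

Lemma eq_meanO X Y c : (forall n w, X n.+3 w = Y n.+3 w) ->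
  meanO X c -> meanO Y c.
Proof.
move=> XY [mX [K hK]]; split=> [n|].
  by apply: eq_bddmom (mX n) => _ w; rewrite XY.
by exists K => n; rewrite -(@eq_Ex _ _ _ _ (X n.+3))//.
Qed.

Lemma meanO_momO X : momO 3 X -> meanO X 0.
Proof.
move=> bX; split=> [n|]; first exact: momO_mom bX.
by have [K hK] := momO_Ex bX; exists K => n; rewrite mul0r subr0.
Qed.

Lemma meanO_D X Y c e : meanO X c -> meanO Y e ->
  meanO (fun n w => X n w + Y n w) (c + e).
Proof.
move=> [mX [K hK]] [mY [L hL]]; split=> [n|]; first exact: momD.
exists (K + L) => n; rewrite ExD// !mulrDl.
rewrite (_ : _ - _ = (Ex P (X n.+3) - c / n.+3%:R) + (Ex P (Y n.+3) - e / n.+3%:R)).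
  by apply: (le_trans (ler_normD _ _)); rewrite lerD.
by ring.
Qed.

Lemma meanO_Z X c k : meanO X c -> meanO (fun n w => k * X n w) (k * c).
Proof.
move=> [mX [K hK]]; split=> [n|]; first exact: momZ.
exists (`|k| * K) => n; rewrite ExZ// -mulrA -mulrBr normrM -mulrA.
by rewrite ler_wpM2l.
Qed.

Lemma meanO_Ex X c K : (forall n, mom P (X n.+3)) ->
  (forall n, `|Ex P (X n.+3) - c / n.+3%:R| <= K / n.+3%:R ^+ 2) -> meanO X c.
Proof.
move=> mX hX; split=> //; exists K => n; apply: le_trans (hX n) _.
have K0 : 0 <= K.
  have := le_trans (normr_ge0 _) (hX 0%N).
  by rewrite pmulr_lge0// invr_gt0 exprn_gt0.
rewrite ler_wpM2l// lef_pV2 ?posrE ?exprn_gt0 ?rt_gt0//.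
by rewrite -rt_sqr -exprM ler_weXn2l// rt_ge1.
Qed.

(** X1 and X2 are not determined by X: terms of order 1/n may move between them. This freedom lets
    X1 be an exact combination of martingale averages, with mean 0. *)
Definition exp3 X (c : R) X1 X2 :=
  [/\ momO 1 X1, momO 2 X2 &
      momO 3 (fun n w => X n w - c - X1 n w - X2 n w)].

Lemma exp3_momO1 X c X1 X2 : exp3 X c X1 X2 -> momO 1 (fun n w => X n w - c).
Proof.
move=> [b1 b2 b3].
have := momOD b1 (momOD (@momO_le 1 2 _ isT b2) (@momO_le 1 3 _ isT b3)).
by apply: eq_momO => n w; ring.
Qed.

Lemma exp3_momO2 X c X1 X2 : exp3 X c X1 X2 ->
  momO 2 (fun n w => X n w - c - X1 n w).
Proof.
move=> [b1 b2 b3].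
have := momOD b2 (@momO_le 2 3 _ isT b3).
by apply: eq_momO => n w; ring.
Qed.

Lemma exp3D X c X1 X2 Y e Y1 Y2 : exp3 X c X1 X2 -> exp3 Y e Y1 Y2 ->
  exp3 (fun n w => X n w + Y n w) (c + e) (fun n w => X1 n w + Y1 n w)
    (fun n w => X2 n w + Y2 n w).
Proof.
move=> [a1 a2 a3] [b1 b2 b3]; split; [exact: momOD|exact: momOD|].
by apply: eq_momO (momOD a3 b3) => n w; ring.
Qed.

Lemma exp3M X c X1 X2 Y e Y1 Y2 : exp3 X c X1 X2 -> exp3 Y e Y1 Y2 ->
  exp3 (fun n w => X n w * Y n w) (c * e)
    (fun n w => c * Y1 n w + e * X1 n w)
    (fun n w => c * Y2 n w + e * X2 n w + X1 n w * Y1 n w).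
Proof.
move=> eX eY; have [a1 a2 a3] := eX; have [b1 b2 b3] := eY.
split.
- by apply: momOD; exact: momOZ.
- by apply: momOD; [apply: momOD; exact: momOZ|exact: (momOM a1 b1)].
have h1 := momOM (exp3_momO1 eX) (exp3_momO2 eY).
have h2 := momOM (exp3_momO2 eX) b1.
have := momOD (momOD h1 h2) (momOD (momOZ c b3) (momOZ e a3)).
by apply: eq_momO => n w; ring.
Qed.

Lemma exp3Z k X c X1 X2 : exp3 X c X1 X2 ->
  exp3 (fun n w => k * X n w) (k * c) (fun n w => k * X1 n w)
    (fun n w => k * X2 n w).
Proof.
move=> [a1 a2 a3]; split; [exact: momOZ|exact: momOZ|].
by apply: eq_momO (momOZ k a3) => n w; ring.
Qed.

(* If 1 + e = Den/d0 then R = (Num/d0)(1 - e + e^2) - R e^3 exactly, so no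
   lower bound on the random denominator is needed once R is bounded. *)
Lemma exp3_quotient (Q N D : nat -> T -> R) (M d0 : R) N1 N2 D1 D2 :
  d0 != 0 -> (forall n, measurable_fun setT (Q n.+3)) ->
  (forall n w, `|Q n.+3 w| <= M) ->
  (forall n w, Q n.+3 w * D n.+3 w = N n.+3 w) ->
  exp3 N 0 N1 N2 -> exp3 D d0 D1 D2 ->
  exp3 Q 0 (fun n w => N1 n w / d0)
    (fun n w => N2 n w / d0 - N1 n w * D1 n w / d0 ^+ 2).
Proof.
move=> d00 mQ QM QD eN eD; have [a1 a2 a3] := eN; have [b1 b2 b3] := eD.
have bQ : momO 0 Q.
  apply: (@bddmom_bounded _ _ _ _ _ _ M) => n.
    by apply: measurable_funM.
  by move=> w; rewrite expr0 mul1r.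
pose e n w := (D n w - d0) / d0.
have be : momO 1 e.
  by apply: eq_momO (momOZ d0^-1 (exp3_momO1 eD)) => n w; rewrite mulrC.
have be2 : momO 2 (fun n w => e n w - D1 n w / d0).
  apply: eq_momO (momOZ d0^-1 (exp3_momO2 eD)) => n w.
  by rewrite /e; field.
have bN : momO 1 N.
  by apply: eq_momO (exp3_momO1 eN) => n w; rewrite subr0.
have bN2 : momO 2 (fun n w => N n w - N1 n w).
  by apply: eq_momO (exp3_momO2 eN) => n w; rewrite subr0.
split.
- by apply: eq_momO (momOZ d0^-1 a1) => n w; rewrite mulrC.
- have := momOB (momOZ d0^-1 a2) (momOZ (d0 ^+ 2)^-1 (momOM a1 b1)).
  by apply: eq_momO => n w; ring.
have h1 := momOZ d0^-1 a3.
have h2 := momOZ d0^-1 (momOM bN2 be).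
have h3 := momOZ d0^-1 (momOM a1 be2).
have h4 := momOZ d0^-1 (momOM bN (momOM be be)).
(* The only term that still contains the quotient; since e^3 has order n^(-3/2), boundedness of [Q]
   is enough. *)
have h5 := momOM bQ (momOM be (momOM be be)).
have := momOB (momOD (momOB h1 h2) (momOB h4 h3)) h5.
apply: eq_momO => n w.
by rewrite /e -(QD n w); field.
Qed.

Lemma exp3_meanO X X1 X2 c1 c2 : exp3 X 0 X1 X2 ->
  meanO X1 c1 -> meanO X2 c2 -> meanO X (c1 + c2).
Proof.
move=> [_ _ /meanO_momO m3] m1 m2.
have := meanO_D (meanO_D m1 m2) m3; rewrite addr0.
by apply: eq_meanO => n w; ring.
Qed.

End expansions.

(** * Averages over the sample and their end effects *)

Section averages.
Context d (T : measurableType d) (R : realType) (P : probability T R).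
Variable z : int -> {RV P >-> R}.
Implicit Types F G : int -> T -> R.

Definition avg (i : nat) F (n : nat) (w : T) : R :=
  n%:R^-1 * \sum_(i <= t < n.+1) F t%:Z w.

Lemma avg_psum F n w : avg 3 F n.+3 w = n.+3%:R^-1 * psum F n.+1 w.
Proof. by []. Qed.

Lemma avgD i F G n w :
  avg i (fun t v => F t v + G t v) n w = avg i F n w + avg i G n w.
Proof. by rewrite /avg big_split mulrDr. Qed.

Lemma avgZ i c F n w : avg i (fun t v => c * F t v) n w = c * avg i F n w.
Proof. by rewrite /avg -mulr_sumr mulrCA. Qed.

Lemma eq_avg i F G n w : (forall t v, F t v = G t v) -> avg i F n w = avg i G n w.
Proof. by move=> FG; congr (_ * _); apply: eq_bigr => t _; exact: FG. Qed.

Lemma avg_mom i F n : bddmom P F -> mom P (avg i F n).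
Proof. by move=> bF; apply: momZ; apply: mom_sum => t; exact: (bddmom_mom _ bF). Qed.

Lemma Ex_avg i F n c : (i <= n.+1)%N -> bddmom P F -> (forall t, Ex P (F t) = c) ->
  Ex P (avg i F n) = n%:R^-1 * ((n.+1 - i)%:R * c).
Proof.
move=> iN bF Fc; rewrite /avg ExZ; last first.
  by apply: mom_sum => t; exact: (bddmom_mom _ bF).
rewrite Ex_sum; last by move=> t; exact: (bddmom_mom _ bF).
by rewrite (eq_bigr (fun=> c)) ?sumr_const_nat ?mulr_natl// => t _; exact: Fc.
Qed.

Lemma avg_shift i F n w : (i <= n.+1)%N ->
  avg i (fun t => F (t - 1)) n w =
  avg i F n w + n%:R^-1 * F (i%:Z - 1) w - n%:R^-1 * F n%:Z w.
Proof.
move=> iN; rewrite /avg -mulrDr -mulrBr; congr (_ * _).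
elim: n iN => [|n IH] iN.
  case: i iN => [|[|//]] _; first by rewrite !big_nat1; ring.
  by rewrite !big_geq// add0r subrr.
rewrite leq_eqVlt in iN; case/orP: iN => [/eqP ->|iN].
  rewrite !big_geq// add0r.
  have -> : n.+2%:Z - 1 = n.+1%:Z :> int by lia.
  by rewrite subrr.
rewrite big_nat_recr//= IH// [in RHS]big_nat_recr//=.
have -> : n.+1%:Z - 1 = n%:Z :> int by lia.
by ring.
Qed.

Lemma momO_avg_shift i F : (i <= 3)%N -> bddmom P F ->
  momO P 2 (fun n w => avg i (fun t => F (t - 1)) n w - avg i F n w).
Proof.
move=> i3 bF.
have h1 := momO2_inv (bddmom_reindex (fun _ : nat => i%:Z - 1) bF).
have h2 := momO2_inv (bddmom_reindex (fun n : nat => n%:Z) bF).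
apply: eq_momO (momOB h1 h2) => n w.
by rewrite avg_shift; [ring|lia].
Qed.

Lemma momO_avg_start i F : (i <= 2)%N -> bddmom P F ->
  momO P 2 (fun n w => avg i F n w - avg i.+1 F n w).
Proof.
move=> i2 bF.
apply: eq_momO (momO2_inv (bddmom_reindex (fun _ : nat => i%:Z) bF)) => n w.
rewrite /avg big_ltn; last by lia.
by ring.
Qed.

Lemma momO_avg_start3 i F : (i <= 3)%N -> bddmom P F ->
  momO P 2 (fun n w => avg i F n w - avg 3 F n w).
Proof.
move=> i3 bF; have z2 : momO P 2 (fun _ (_ : T) => 0).
  by apply: (@momO_det _ _ _ _ _ (fun=> 0) 0) => n; rewrite normr0 mulr0.
have h2 := @momO_avg_start 2 _ isT bF.
have h1 := momOD (@momO_avg_start 1 _ isT bF) h2.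
have h0 := momOD (@momO_avg_start 0 _ isT bF) h1.
case: i i3 => [|[|[|[|//]]]] _.
- by apply: eq_momO h0 => n w; ring.
- by apply: eq_momO h1 => n w; ring.
- by apply: eq_momO h2 => n w; ring.
- by apply: eq_momO z2 => n w; rewrite subrr.
Qed.

(** A shift or a new starting index changes only a bounded number of boundary terms. Thus sample
    autocovariances of equal lag share their first-order term and differ only from order 1/n on. *)
Lemma momO_avg_lag i m F : (i <= 3)%N -> bddmom P F ->
  momO P 2 (fun n w => avg i (fun t => F (t - m%:Z)) n w - avg 3 F n w).
Proof.
move=> i3; elim: m F => [|m IH] F bF.
  apply: eq_momO (momO_avg_start3 i3 bF) => n w; congr (_ - _).
  by apply: eq_avg => t v; rewrite subr0.
have bF1 : bddmom P (fun t => F (t - 1)) by exact: (bddmom_reindex (fun t => t - 1)).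
have h1 := IH _ bF1; have h2 := @momO_avg_shift 3 _ isT bF.
apply: eq_momO (momOD h1 h2) => n w; rewrite addrA subrK; congr (_ - _).
apply: eq_avg => t v; congr (F _ v); lia.
Qed.

Section martingale_differences.
Variable D : int -> T -> R.
Hypotheses (bD : bddmom P D) (aD : forall t, pastm z (t + 1) (D t))
  (oD : forall t Y, pastm z t Y -> mom P Y ->
     Ex P (fun w => D t w * Y w) = 0).

Lemma momO1_avg : momO P 1 (avg 3 D).
Proof.
apply: bddmom_evenP => [n|k]; first by apply: momZ; exact: avg_mom.
have [C hC] := psum_moment bD aD oD k; exists C => n.
pose M := psum D n.+1.
have rn0 := rt_neq0 R n; have rg := rt_gt0 R n.
rewrite (@eq_Ex _ _ _ P _ (fun w => (rt R n ^+ (2 * k))^-1 * M w ^+ (2 * k))); last first.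
  move=> w; rewrite avg_psum -rt_sqr expr1 mulrA expr2 invfM mulrA mulfV// mul1r.
  by rewrite exprMn exprVn.
rewrite ExZ; last by apply: momX; exact: psum_mom.
rewrite mulrC ler_pdivrMr ?exprn_gt0// exprM rt_sqr.
by apply: hC => //; lia.
Qed.

Lemma meanO_avg : meanO P (avg 3 D) 0.
Proof.
split=> [n|]; first exact: avg_mom.
exists 0 => n; rewrite mul0r subr0 ExZ; last exact: (psum_mom n.+1 bD).
by rewrite (Ex_psum bD oD) mulr0 normr0 mul0r.
Qed.

Lemma meanO_avgM (D' : int -> T -> R) (c : R) :
  bddmom P D' -> (forall t, pastm z (t + 1) (D' t)) ->
  (forall t Y, pastm z t Y -> mom P Y -> Ex P (fun w => D' t w * Y w) = 0) ->
  (forall t, Ex P (fun w => D t w * D' t w) = c) ->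
  meanO P (fun n w => avg 3 D n w * avg 3 D' n w) c.
Proof.
move=> bD' aD' oD' cD; apply: (@meanO_Ex _ _ _ _ _ _ (2 * `|c|)) => n.
  by apply: momM; exact: avg_mom.
rewrite (@eq_Ex _ _ _ P _ (fun w => (n.+3%:R ^+ 2)^-1 *
  (psum D n.+1 w * psum D' n.+1 w))); last first.
  move=> w; rewrite !avg_psum; have : n.+3%:R != 0 :> R by rewrite pnatr_eq0.
  by move: n.+3%:R => N N0; field.
rewrite ExZ; last by apply: momM; exact: psum_mom.
rewrite (psum_cross bD aD oD n.+1 bD' aD' oD' cD).
have -> : n.+3%:R = n.+1%:R + 2 :> R by rewrite -natrD addn2.
have n0 : n.+1%:R + 2 != 0 :> R by rewrite -natrD pnatr_eq0 addn2.
set N := n.+1%:R in n0 *.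
(* The sample size is N + 2 and the sum has N terms: the two missing ones are the whole error. *)
rewrite (_ : _ - _ = - (2 * c / (N + 2) ^+ 2)); last by field.
rewrite normrN !normrM normfV (ger0_norm (sqr_ge0 (N + 2))).
by rewrite (ger0_norm (ler0n R 2)).
Qed.

End martingale_differences.
End averages.

(** * A quadratic form contracted by the AR(2) recursion *)

Section ar2_contraction.
Context (R : realType).

(* In the coordinates (x_t, q_t), q_t = x_{t-1} - rho x_t, the noiseless
   recursion maps q^2 + r x^2 to phi^2 q^2 + r x^2; applied twice it is a strict
   contraction because q_t and q_{t+1} cannot both vanish. *)
Lemma ar2_contraction (rho phi : R) : `|rho| < 1 -> `|phi| < 1 ->
  exists c K : R, [/\ 0 <= c < 1, 0 <= K & forall u q a1 a2 : R,
    let r := 1 - rho ^+ 2 in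
    let x1 := rho * u + phi * q + a1 in let q1 := u - rho * x1 in
    let x2 := rho * x1 + phi * q1 + a2 in let q2 := x1 - rho * x2 in
    q2 ^+ 2 + r * x2 ^+ 2 <= c * (q ^+ 2 + r * u ^+ 2) + K * (a1 ^+ 2 + a2 ^+ 2)].
Proof.
rewrite !ltr_norml => /andP[rho0 rho1] /andP[phi0 phi1].
have rr : 0 < 1 - rho ^+ 2 by nra.
have rr1 : 1 - rho ^+ 2 <= 1 by nra.
have pp : 0 < 1 - phi ^+ 2 by nra.
have pp1 : 1 - phi ^+ 2 <= 1 by nra.
set r := 1 - rho ^+ 2 in rr rr1.
(* Two noiseless steps lose (1 - phi^2)(q^2 + q0'^2) ([e1]), and q^2 + q0'^2 is at least r/3 times
   the form ([k1]). *)
pose c0 := 1 - (1 - phi ^+ 2) * r / 3.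
have c01 : c0 < 1 by rewrite /c0 ltrBlDr ltrDl divr_gt0// mulr_gt0.
have c00 : 0 <= c0 by rewrite /c0; nra.
(* Part of the gap pays for splitting off the noise: (1 + e) c0 = 1 - (1 - c0)(2 - c0)/2 < 1. *)
pose e := (1 - c0) / 2.
have e0 : 0 < e by rewrite divr_gt0// subr_gt0.
have sq (A B : R) : (A + B) ^+ 2 <= (1 + e) * A ^+ 2 + (1 + e^-1) * B ^+ 2.
  have : 0 <= e^-1 * (e * A - B) ^+ 2 by rewrite mulr_ge0 ?sqr_ge0// invr_ge0 ltW.
  have -> : e^-1 * (e * A - B) ^+ 2 = e * A ^+ 2 - 2 * A * B + e^-1 * B ^+ 2.
    by field; rewrite gt_eqF.
  lra.
exists ((1 + e) * c0), (10 * (1 + e^-1)); split.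
- by rewrite /e; apply/andP; split; nra.
- by rewrite mulr_ge0// addr_ge0// invr_ge0 ltW.
move=> u q a1 a2 /=; rewrite -/r.
(* [X1], [q0'] are the noiseless coordinates after one step and [X], [Q] after two; [w1], [w2] are
   the noise parts after two steps. *)
pose X1 := rho * u + phi * q; pose q0' := r * u - rho * phi * q.
pose X := rho * X1 + phi * q0'; pose Q := X1 - rho * X.
pose w1 := rho * (1 - phi) * a1 + a2.
pose w2 := (r + rho ^+ 2 * phi) * a1 - rho * a2.
rewrite (_ : rho * (rho * u + phi * q + a1) + phi * (u - rho * (rho * u + phi * q + a1)) + a2
  = X + w1); last by rewrite /X /q0' /X1 /w1 /r; ring.
rewrite (_ : rho * u + phi * q + a1 - rho * (X + w1) = Q + w2); last first.
  by rewrite /Q /X /q0' /X1 /w1 /w2 /r; ring.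
have hX := ler_wpM2l (ltW rr) (sq X w1); have hQ := sq Q w2.
have e1 : Q ^+ 2 + r * X ^+ 2 =
    q ^+ 2 + r * u ^+ 2 - (1 - phi ^+ 2) * (q ^+ 2 + q0' ^+ 2).
  by rewrite /Q /X /q0' /X1 /r; ring.
have k1 : r * (q ^+ 2 + r * u ^+ 2) <= 3 * (q ^+ 2 + q0' ^+ 2).
  have -> : r * (q ^+ 2 + r * u ^+ 2) = r * q ^+ 2 + (q0' + rho * phi * q) ^+ 2.
    by rewrite /q0'; ring.
  have h : (q0' + rho * phi * q) ^+ 2 <= 2 * q0' ^+ 2 + 2 * (rho * phi) ^+ 2 * q ^+ 2.
    have := sqr_ge0 (q0' - rho * phi * q); nra.
  have h2 : (rho * phi) ^+ 2 <= 1 by rewrite exprMn; nra.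
  have := sqr_ge0 q; have := sqr_ge0 q0'.
  have h3 : (rho * phi) ^+ 2 * q ^+ 2 <= q ^+ 2 by rewrite ler_piMl ?sqr_ge0.
  have h4 : r * q ^+ 2 <= q ^+ 2 by rewrite ler_piMl ?sqr_ge0.
  lra.
have main : Q ^+ 2 + r * X ^+ 2 <= c0 * (q ^+ 2 + r * u ^+ 2).
  rewrite e1 /c0; have := ler_wpM2l (ltW pp) k1.
  set A := q ^+ 2 + r * u ^+ 2; set B := q ^+ 2 + q0' ^+ 2; lra.
have b1 : r * w1 ^+ 2 <= 8 * a1 ^+ 2 + 2 * a2 ^+ 2.
  apply: (@le_trans _ _ (w1 ^+ 2)); first by rewrite ler_piMl ?sqr_ge0.
  have h : w1 ^+ 2 <= 2 * (rho * (1 - phi)) ^+ 2 * a1 ^+ 2 + 2 * a2 ^+ 2.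
    have := sqr_ge0 (rho * (1 - phi) * a1 - a2); rewrite /w1; nra.
  have h2 : (rho * (1 - phi)) ^+ 2 <= 4 by rewrite exprMn; nra.
  have := ler_wpM2r (sqr_ge0 a1) h2; lra.
have b2 : w2 ^+ 2 <= 2 * a1 ^+ 2 + 2 * a2 ^+ 2.
  have h : w2 ^+ 2 <= 2 * (r + rho ^+ 2 * phi) ^+ 2 * a1 ^+ 2 + 2 * rho ^+ 2 * a2 ^+ 2.
    have := sqr_ge0 ((r + rho ^+ 2 * phi) * a1 + rho * a2); rewrite /w2; nra.
  have h2 : (r + rho ^+ 2 * phi) ^+ 2 <= 1.
    have g1 : r + rho ^+ 2 * phi <= 1 by rewrite /r; have := sqr_ge0 rho; nra.
    have g2 : - 1 <= r + rho ^+ 2 * phi by rewrite /r; have := sqr_ge0 rho; nra.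
    nra.
  have h3 : rho ^+ 2 <= 1 by nra.
  have := ler_wpM2r (sqr_ge0 a1) h2; have := ler_wpM2r (sqr_ge0 a2) h3; lra.
have e10 : 0 <= 1 + e^-1 by rewrite addr_ge0// invr_ge0 ltW.
have e11 : 0 <= 1 + e by rewrite addr_ge0// ltW.
have m1 := ler_wpM2l e11 main.
have b3 : w2 ^+ 2 + r * w1 ^+ 2 <= 10 * (a1 ^+ 2 + a2 ^+ 2).
  have := sqr_ge0 a2; lra.
have m2 := ler_wpM2l e10 b3.
apply: (le_trans (lerD hQ hX)).
move: m1 m2; set A := 1 + e; set B := 1 + e^-1.
set c3 := _ ^+ 2 + r * u ^+ 2; set c4 := a1 ^+ 2 + _.
set y1 := Q ^+ 2; set y2 := X ^+ 2; set y3 := w2 ^+ 2; set y4 := w1 ^+ 2.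
lra.
Qed.

End ar2_contraction.

(** * Burg estimators of a path *)

Section burg_bounds.
Context (R : realType).

(* With k = 2F/D the denominator is D^2 V, where V is the sum of the squared
   forward and backward residuals. When D = 0 or V = 0 all terms vanish, so the
   identities survive the convention x/0 = 0. *)
Lemma burg_quotient (C D E F G H : R) :
  `|2 * F| <= D ->
  (forall k, 0 <= C - 2 * E <= 2 * (C + 2 * k ^+ 2 * G - 2 * k * H)) ->
  let Den := C * D ^+ 2 + 8 * F ^+ 2 * G - 4 * F * H * D in
  let q := (C * D ^+ 2 - 2 * E * D ^+ 2) / Den in
  [/\ 0 <= q <= 2, q * Den = (C - 2 * E) * D ^+ 2 &
      2 * F / D * q * Den = 2 * F * D * (C - 2 * E)].
Proof.
move=> FD hk Den q; have [D0|D0] := eqVneq D 0.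
  have F0 : F = 0.
    by move: FD; rewrite D0 normr_le0 mulf_eq0 pnatr_eq0 /= => /eqP.
  have Den0 : Den = 0 by rewrite /Den D0 F0; ring.
  by rewrite /q Den0 D0 F0 invr0 !(mulr0, mul0r, expr0n) lexx ler0n.
pose k := 2 * F / D.
have kD : 2 * F = k * D by rewrite /k divfK.
have [/andP[h0 h1]] := (hk k, tt).
set V := C + 2 * k ^+ 2 * G - 2 * k * H in h1.
have DenE : Den = D ^+ 2 * V.
  have -> : Den = C * D ^+ 2 + 2 * (2 * F) ^+ 2 * G - 2 * (2 * F) * H * D.
    by rewrite /Den; ring.
  by rewrite kD /V; ring.
have V0 : 0 <= V by lra.
have qE : q = (C - 2 * E) / V.
  rewrite /q DenE; have [->|Vn0] := eqVneq V 0; first by rewrite mulr0 invr0 !mulr0.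
  by field; rewrite D0 Vn0.
have q2 : q * Den = (C - 2 * E) * D ^+ 2.
  rewrite DenE qE; have [Ve|Vn0] := eqVneq V 0.
    have -> : C - 2 * E = 0 by apply/eqP; rewrite eq_le h0 andbT; move: h1; rewrite Ve mulr0.
    by rewrite !mul0r.
  by field.
split=> //.
  have [Ve|Vn0] := eqVneq V 0; first by rewrite qE Ve invr0 mulr0 lexx ler0n.
  have Vp : 0 < V by rewrite lt_neqAle eq_sym Vn0.
  by rewrite qE divr_ge0//= ler_pdivrMr.
by rewrite -mulrA q2 -/k kD; ring.
Qed.

Section path.
Variables (y : int -> R) (n : nat).

Let e (t : int) := y t - sample_mean y n.
Let N0 : 0 <= n%:R^-1 :> R. Proof. by rewrite invr_ge0. Qed.

Lemma burg_FD : `|2 * burgF y n| <= burgD y n.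
Proof.
have sE m k : Sbar y n m k 2 = n%:R^-1 * \sum_(2 <= t < n.+1)
  e (t%:Z - m%:Z) * e (t%:Z - k%:Z) by [].
rewrite /burgF /burgD !sE -mulrDr mulrCA -big_split normrM ger0_norm//.
rewrite ler_wpM2l// mulr_sumr.
apply: (le_trans (ler_norm_sum _ _ _)); apply: ler_sum => t _ /=.
rewrite ler_norml; set u := e (_ - 0%:Z); set v := e (_ - 1%:Z).
have := sqr_ge0 (u - v); have := sqr_ge0 (u + v); rewrite !expr2; nra.
Qed.

(** Let u, v, w be the deviations at t, t-1, t-2. Then C - 2E averages (u - w)^2 and the bracket on
    the right averages (u - kv)^2 + (w - kv)^2; compare termwise, using u - w = (u - kv) - (w -
    kv). *)
Lemma burg_CE k : 0 <= burgC y n - 2 * burgE y n <=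
  2 * (burgC y n + 2 * k ^+ 2 * burgG y n - 2 * k * burgH y n).
Proof.
have sE m j : Sbar y n m j 3 = n%:R^-1 * \sum_(3 <= t < n.+1)
  e (t%:Z - m%:Z) * e (t%:Z - j%:Z) by [].
have -> : burgC y n - 2 * burgE y n =
    n%:R^-1 * \sum_(3 <= t < n.+1) (e (t%:Z - 0%:Z) - e (t%:Z - 2%:Z)) ^+ 2.
  rewrite /burgC /burgE !sE -mulrDr mulrCA -mulrBr; congr (_ * _).
  rewrite mulr_sumr -big_split -sumrB; apply: eq_bigr => t _ /=; ring.
have -> : burgC y n + 2 * k ^+ 2 * burgG y n - 2 * k * burgH y n =
    n%:R^-1 * \sum_(3 <= t < n.+1) ((e (t%:Z - 0%:Z) - k * e (t%:Z - 1%:Z)) ^+ 2 +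
      (e (t%:Z - 2%:Z) - k * e (t%:Z - 1%:Z)) ^+ 2).
  rewrite /burgC /burgG /burgH !sE -!mulrDr.
  rewrite [2 * k ^+ 2 * _]mulrCA [2 * k * _]mulrCA -mulrDr -mulrBr; congr (_ * _).
  rewrite -!big_split /= !mulr_sumr -big_split -sumrB.
  by apply: eq_bigr => t _ /=; ring.
apply/andP; split.
  by rewrite mulr_ge0// sumr_ge0// => t _; exact: sqr_ge0.
rewrite mulrCA ler_wpM2l// mulr_sumr; apply: ler_sum => t _.
set u := e (_ - 0%:Z); set v := e (_ - 1%:Z); set w := e (_ - 2%:Z).
have := sqr_ge0 ((u - k * v) + (w - k * v)); lra.
Qed.

Definition burg_den : R := burgC y n * burgD y n ^+ 2 +
  8 * burgF y n ^+ 2 * burgG y n - 4 * burgF y n * burgH y n * burgD y n.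

Lemma burg_phi2_bound : `|burg_phi2 y n| <= 1.
Proof.
have [/andP[q0 q2] _ _] := burg_quotient burg_FD burg_CE.
by rewrite /burg_phi2 ler_norml; apply/andP; split; lra.
Qed.

Lemma burg_phi1_bound : `|burg_phi1 y n| <= 2.
Proof.
have [/andP[q0 q2] _ _] := burg_quotient burg_FD burg_CE.
have h : `|2 * burgF y n / burgD y n| <= 1.
  have D0 : 0 <= burgD y n by exact: le_trans burg_FD.
  rewrite normrM normfV (ger0_norm D0); have [->|Dn0] := eqVneq (burgD y n) 0.
    by rewrite invr0 mulr0.
  by rewrite ler_pdivrMr ?mul1r ?burg_FD// lt_neqAle eq_sym Dn0.
rewrite /burg_phi1 normrM; apply: (@le_trans _ _ (1 * 2)); last by rewrite mul1r.
by rewrite ler_pM// /burg_phi2 opprB addrC subrK ger0_norm.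
Qed.

(** Valid also where [burg_den] is 0, so the quotient expansion applies at every sample point, with
    no exceptional event. *)
Lemma burg_phi2_den (f : R) : (burg_phi2 y n - f) * burg_den =
  (1 - f) * burg_den - (burgC y n - 2 * burgE y n) * burgD y n ^+ 2.
Proof.
have [_ qD _] := burg_quotient burg_FD burg_CE.
rewrite -qD /burg_phi2 -/burg_den; set q := _ / _; ring.
Qed.

Lemma burg_phi1_den (f : R) : (burg_phi1 y n - f) * burg_den =
  2 * burgF y n * burgD y n * (burgC y n - 2 * burgE y n) - f * burg_den.
Proof.
have [_ _ qD] := burg_quotient burg_FD burg_CE.
rewrite -qD /burg_phi1 /burg_phi2 -/burg_den.
set q := (_ - _) / _; set k := 2 * _ / _; ring.
Qed.

End path.
End burg_bounds.

(** * Measurability of the estimators *)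

Section measurability.
Context d (T : measurableType d) (R : realType).

(* [x^-1 = x * (x ^+ 2) `^ (-1)], also at [x = 0]. *)
Lemma measurable_funV (f : T -> R) : measurable_fun setT f ->
  measurable_fun setT (fun w => (f w)^-1).
Proof.
move=> mf; have mf2 : measurable_fun setT (fun w => (f w ^+ 2) `^ (-1)).
  by apply: (measurableT_comp (measurable_powR (-1))); exact: measurable_funX.
apply: (eq_measurable_fun (fun w => f w * (f w ^+ 2) `^ (-1))).
  move=> w _; rewrite powR_inv1 ?sqr_ge0//.
  have [->|f0] := eqVneq (f w) 0; first by rewrite invr0 mul0r.
  by field.
exact: measurable_funM.
Qed.

Variable z : int -> T -> R.
Hypothesis mz : forall t, measurable_fun setT (z t).

Let msum (s : seq nat) (F : nat -> T -> R) :
  (forall t, measurable_fun setT (F t)) ->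
  measurable_fun setT (fun w => \sum_(t <- s) F t w).
Proof. by move=> mF; exact: measurable_sum. Qed.

Lemma measurable_Sbar n m k i :
  measurable_fun setT (fun w => Sbar (fun t => z t w) n m k i).
Proof.
have mm : measurable_fun setT (fun w => sample_mean (fun t => z t w) n).
  by apply: measurable_funM => //; exact: msum.
apply: measurable_funM => //; apply: msum => t.
by apply: measurable_funM; exact: measurable_funB.
Qed.

Let mC n : measurable_fun setT (fun w => burgC (fun t => z t w) n).
Proof. by apply: measurable_funD; exact: measurable_Sbar. Qed.
Let mD n : measurable_fun setT (fun w => burgD (fun t => z t w) n).
Proof. by apply: measurable_funD; exact: measurable_Sbar. Qed.
Let mE n : measurable_fun setT (fun w => burgE (fun t => z t w) n).
Proof. exact: measurable_Sbar. Qed.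
Let mF n : measurable_fun setT (fun w => burgF (fun t => z t w) n).
Proof. exact: measurable_Sbar. Qed.
Let mG n : measurable_fun setT (fun w => burgG (fun t => z t w) n).
Proof. exact: measurable_Sbar. Qed.
Let mH n : measurable_fun setT (fun w => burgH (fun t => z t w) n).
Proof. by apply: measurable_funD; exact: measurable_Sbar. Qed.

Lemma measurable_burg_phi2 n :
  measurable_fun setT (fun w => burg_phi2 (fun t => z t w) n).
Proof.
apply: measurable_funB => //; apply: measurable_funM.
  apply: measurable_funB; apply: measurable_funM => //.
  - exact: measurable_funX.
  - exact: measurable_funM.
  - exact: measurable_funX.
apply: measurable_funV; apply: measurable_funB.
  apply: measurable_funD.
    by apply: measurable_funM => //; exact: measurable_funX.
  by apply: measurable_funM => //; apply: measurable_funM => //; exact: measurable_funX.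
by apply: measurable_funM => //; apply: measurable_funM => //; exact: measurable_funM.
Qed.

Lemma measurable_burg_phi1 n :
  measurable_fun setT (fun w => burg_phi1 (fun t => z t w) n).
Proof.
apply: measurable_funM; last first.
  by apply: measurable_funB => //; exact: measurable_burg_phi2.
by apply: measurable_funM; [exact: measurable_funM|exact: measurable_funV].
Qed.

End measurability.

Section expansion_tools.
Context d (T : measurableType d) (R : realType) (P : probability T R).

Lemma eq_exp3 X X' (c c' : R) X1 X2 X1' X2' :
  exp3 P X c X1 X2 -> (forall n (w : T), X n w = X' n w) -> c = c' ->
  (forall n w, X1 n w = X1' n w) -> (forall n w, X2 n w = X2' n w) ->
  exp3 P X' c' X1' X2'.
Proof.
move=> h eX ec e1 e2.
have {}eX : X = X' by apply/funext => n; apply/funext => w; exact: eX.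
have {}e1 : X1 = X1' by apply/funext => n; apply/funext => w; exact: e1.
have {}e2 : X2 = X2' by apply/funext => n; apply/funext => w; exact: e2.
by case: _ / eX; case: _ / ec; case: _ / e1; case: _ / e2.
Qed.

Lemma meanO_expectation (Q : nat -> T -> R) (c : R) : meanO P Q c ->
  exists r : nat -> R, r =o_\oo (fun n : nat => n%:R^-1 : R) /\
    \forall n \near \oo, 'E_P[Q n]%E = (c / n%:R + r n)%:E.
Proof.
move=> [mQ [K hK]]; exists (fun n => Ex P (Q n) - c / n%:R); split.
  apply/eqoP => _/posnumP[e].
  (* n >= M^2 gives K / sqrt n <= e; the 3 allows n to be written as m+3. *)
  pose M := Num.bound (`|K| / e%:num); exists (M * M + 3)%N => // n /= Mn.
  have [m nm] : exists m, n = m.+3 by exists (n - 3)%N; lia.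
  rewrite nm; apply: (le_trans (hK m)).
  rewrite ger0_norm ?invr_ge0// -(rt_sqr R m) ler_pdivrMr ?exprn_gt0 ?rt_gt0//.
  have -> : e%:num * (rt R m ^+ 2)^-1 * rt R m ^+ 3 = rt R m * e%:num.
    by field; exact: rt_neq0.
  rewrite -ler_pdivrMr//.
  apply: le_trans (_ : `|K| / e%:num <= _); first by rewrite ler_wpM2r ?ler_norm.
  apply: ltW; apply: (lt_le_trans (archi_boundP _)) => //.
  rewrite -/M -ler_sqr ?nnegrE ?rt_ge0// rt_sqr -natrX ler_nat -nm -mulnn.
  by apply: leq_trans Mn; exact: leq_addr.
exists 3%N => // n /= n3; have [m nm] : exists m, n = m.+3 by exists (n - 3)%N; lia.
rewrite nm expectation.unlock integral_Ex//.
by rewrite addrC subrK.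
Qed.

End expansion_tools.

(** * The AR(2) process *)

Section ar2.
Fact dev_key : unit. Proof. exact: tt. Qed.

Context d (T : measurableType d) (R : realType) (P : probability T R).
Variables (phi1 phi2 mu sigma : R) (a z : int -> {RV P >-> R}).
Hypotheses (hphi2 : `|phi2| < 1) (hsum : phi1 + phi2 < 1)
  (hdiff : phi2 - phi1 < 1) (hsigma : 0 < sigma)
  (hz : gaussian_AR2 phi1 phi2 mu sigma a z).

(* Locked, lest unification read [Ex (dev t)] as the expectation of a difference. *)
Definition dev := locked_with dev_key (fun (t : int) (w : T) => z t w - mu).
Local Notation x := dev.

Lemma dev_fun t : x t = (fun w => z t w - mu).
Proof. by rewrite /dev locked_withE. Qed.

Lemma obsE t w : z t w = x t w + mu.
Proof. by rewrite dev_fun subrK. Qed.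

Lemma measurable_dev t : measurable_fun setT (x t).
Proof. by rewrite dev_fun; apply: measurable_funB. Qed.

Lemma devE t w : x t w = phi1 * x (t - 1) w + phi2 * x (t - 2) w + a t w.
Proof. by rewrite !dev_fun; exact: (ar2_equation hz). Qed.

Lemma bddmom_innov : bddmom P (fun t => a t : T -> R).
Proof. exact: (bddmom_normal hsigma (ar2_innovations_normal hz)). Qed.

Lemma covariance_dev s t :
  covariance P (z s) (z t) = (\int[P]_w (x s w * x t w)%:E)%E.
Proof.
have [_ zmu _] := ar2_stationary hz.
by rewrite covariance.unlock !zmu expectation.unlock !dev_fun.
Qed.

Lemma integrable_dev2 t : P.-integrable setT (EFin \o (fun w => x t w ^+ 2)).
Proof.
have [zL _ _] := ar2_stationary hz.
have iz := Lfun2_integrable_sqr (zL t).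
have i1 : P.-integrable setT (EFin \o (fun w => 2 * z t w ^+ 2 + 2 * mu ^+ 2)).
  have i2 := integrableD measurableT (integrableZl measurableT 2 iz)
    (finite_measure_integrable_cst P (2 * mu ^+ 2) measurableT).
  by apply: eq_integrable i2.
apply: (le_integrable measurableT _ _ i1).
  apply/measurable_EFinP; apply: measurable_funX; exact: measurable_dev.
move=> w _; rewrite lee_fin ger0_norm ?sqr_ge0// ger0_norm; last first.
  by rewrite addr_ge0// mulr_ge0// sqr_ge0.
by have := sqr_ge0 (z t w + mu); rewrite dev_fun; nra.
Qed.

Lemma integral_dev2 : exists C : R, 0 <= C /\ forall t,
  (\int[P]_w (x t w ^+ 2)%:E <= C%:E)%E.
Proof.
have [_ _ zst] := ar2_stationary hz.
have := integrable_fin_num measurableT (integrable_dev2 0).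
set I := (\int[P]_w _)%E => If; exists (fine I); split.
  by apply: fine_ge0; apply: integral_ge0 => w _; rewrite lee_fin sqr_ge0.
move=> t; rewrite fineK//.
have := zst 0 0 t; rewrite !add0r !covariance_dev => h.
under eq_integral do rewrite expr2.
rewrite h /I.
by under [leRHS]eq_integral do rewrite /= expr2.
Qed.

(** The lag-one autocorrelation ([yw1]). In the coordinates (rho, phi2), the partial
    autocorrelations, the triangle of stationarity becomes the square |rho| < 1, |phi2| < 1. *)
Definition rho : R := phi1 / (1 - phi2).

Lemma one_sub_phi2_gt0 : 0 < 1 - phi2.
Proof. by move: hphi2; rewrite ltr_norml subr_gt0 => /andP[]. Qed.

Lemma phi1E : phi1 = rho * (1 - phi2).
Proof. by rewrite /rho divfK// gt_eqF// one_sub_phi2_gt0. Qed.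

Lemma rho_lt1 : `|rho| < 1.
Proof.
have p := one_sub_phi2_gt0.
rewrite /rho normrM normfV (gtr0_norm p) ltr_pdivrMr// mul1r ltr_norml.
rewrite opprB ltrBlDr -ltrBlDl hdiff /=.
by rewrite ltrBrDr hsum.
Qed.

Lemma bddmom_dev : bddmom P x.
Proof.
have [c [K [c01 K0 hc]]] := ar2_contraction rho_lt1 hphi2.
have [C [C0 hC]] := integral_dev2.
have r0 : 0 < 1 - rho ^+ 2.
  have := rho_lt1; rewrite ltr_norml => /andP[? ?]; nra.
have r1 : 1 - rho ^+ 2 <= 1 by have := sqr_ge0 rho; lra.
pose Y t w := (x (t - 1) w - rho * x t w) ^+ 2 + (1 - rho ^+ 2) * x t w ^+ 2.
pose al t w := K * (a (t - 1) w ^+ 2 + a t w ^+ 2).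
have mY t : measurable_fun setT (Y t).
  apply: measurable_funD.
    apply: measurable_funX; apply: measurable_funB; first exact: measurable_dev.
    by apply: measurable_funM => //; exact: measurable_dev.
  apply: measurable_funM => //; apply: measurable_funX; exact: measurable_dev.
have Y0 t w : 0 <= Y t w.
  by apply: addr_ge0; [exact: sqr_ge0|apply: mulr_ge0; [exact: ltW|exact: sqr_ge0]].
have bY : bddmom P Y.
  (* Since rho^2 <= 1, Y_t <= 2 x_(t-1)^2 + 3 x_t^2, and stationarity bounds both second moments by
     C. *)
  apply: (@contraction_bddmom _ _ _ _ Y al c (2 * C + 3 * C)) => //.
  - by move=> t w; rewrite mulr_ge0// addr_ge0 ?sqr_ge0.
  - apply: bddmomZ; apply: bddmomD; last exact: (bddmomX 2 bddmom_innov).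
    exact: (bddmom_reindex (fun t => t - 1) (bddmomX 2 bddmom_innov)).
  - move=> t.
    have m2 u : measurable_fun setT (fun w => x u w ^+ 2).
      by apply: measurable_funX; exact: measurable_dev.
    apply: (@le_trans _ _ (\int[P]_w (2 * x (t - 1) w ^+ 2 + 3 * x t w ^+ 2)%:E)%E).
      apply: ge0_le_integral => //.
      + by move=> w _; rewrite lee_fin.
      + exact/measurable_EFinP.
      + by apply/measurable_EFinP; apply: measurable_funD; apply: measurable_funM.
      + move=> w _; rewrite lee_fin /Y.
        set u := x (t - 1) w; set v := x t w.
        have h1 : (u - rho * v) ^+ 2 <= 2 * u ^+ 2 + 2 * rho ^+ 2 * v ^+ 2.
          have := sqr_ge0 (u + rho * v); nra.
        have := sqr_ge0 v => v2.
        have r2 : 0 <= rho ^+ 2 by exact: sqr_ge0.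
        have r3 : rho ^+ 2 <= 1 by lra.
        have := ler_wpM2r v2 r3; have := ler_wpM2r v2 r1; lra.
    apply: ge0_integral_le_add.
    + exact: measurable_funM.
    + exact: measurable_funM.
    + by move=> w; rewrite mulr_ge0 ?sqr_ge0.
    + by move=> w; rewrite mulr_ge0 ?sqr_ge0.
    + by apply: ge0_integral_leZ => // w; rewrite sqr_ge0.
    + by apply: ge0_integral_leZ => // w; rewrite sqr_ge0.
  - move=> t w; rewrite /Y /al.
    have E (s : int) : x s w = rho * x (s - 1) w + phi2 * (x (s - 2) w - rho * x (s - 1) w) + a s w.
      rewrite devE {1}phi1E; ring.
    have := hc (x (t - 2) w) (x (t - 3) w - rho * x (t - 2) w) (a (t - 1) w) (a t w).
    have e1 := E (t - 1).
    have i1 : t - 1 - 1 = t - 2 by ring.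
    have i2 : t - 1 - 2 = t - 3 by ring.
    have i3 : t - 2 - 1 = t - 3 by ring.
    rewrite i1 i2 in e1; rewrite i3 /= -e1.
    by rewrite -E.
have b1 : bddmom P (fun t w => 1 + (1 - rho ^+ 2)^-1 * Y t w).
  by apply: bddmomD; [exact: bddmom1|exact: bddmomZ].
apply: (bddmom_le _ _ b1); first exact: measurable_dev.
move=> t w.
have h : x t w ^+ 2 <= (1 - rho ^+ 2)^-1 * Y t w.
  by rewrite ler_pdivlMl// /Y lerDr sqr_ge0.
have h0 : 0 <= (1 - rho ^+ 2)^-1 * Y t w by rewrite mulr_ge0// invr_ge0 ltW.
rewrite [leRHS]ger0_norm ?addr_ge0//; apply: le_trans (_ : 1 + x t w ^+ 2 <= _).
  rewrite -[_ ^+ 2]real_normK ?num_real//.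
  have := sqr_ge0 (`|x t w| - 1); have := normr_ge0 (x t w); nra.
by rewrite lerD2l.
Qed.

Lemma mom_dev t : mom P (x t). Proof. exact: (bddmom_mom t bddmom_dev). Qed.
Lemma mom_innov t : mom P (a t). Proof. exact: (bddmom_mom t bddmom_innov). Qed.

Lemma Ex_dev t : Ex P (x t) = 0.
Proof.
have [zL zmu _] := ar2_stationary hz.
have mz : mom P (z t).
  apply: eq_bddmom (momD (mom_dev t) (mom_cst P mu)) => _ w; exact/esym/obsE.
rewrite dev_fun ExB//; last exact: mom_cst.
have := zmu t; rewrite unlock integral_Ex// => -[->].
by rewrite Ex_cst subrr.
Qed.

Lemma past_dev t s : s < t -> pastm z t (x s).
Proof. by move=> st; rewrite dev_fun; apply: pastmB; [exact: pastm_z|exact: pastm_cst]. Qed.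

Lemma Ex_innov t : Ex P (a t) = 0.
Proof.
have m1 := mom_dev t; have m2 := mom_dev (t - 1); have m3 := mom_dev (t - 2).
rewrite (@eq_Ex _ _ _ P _ (fun w => x t w - (phi1 * x (t - 1) w + phi2 * x (t - 2) w))).
  rewrite ExB//; last by apply: momD; exact: momZ.
  rewrite ExD; [|exact: momZ|exact: momZ].
  by rewrite !ExZ// !Ex_dev; ring.
by move=> w; rewrite [x t w]devE; ring.
Qed.

(** Adaptedness is read off from the AR(2) equation solved for the innovation. *)
Lemma past_innov t : pastm z (t + 1) (a t).
Proof.
have e : forall w, x t w - (phi1 * x (t - 1) w + phi2 * x (t - 2) w) = a t w.
  by move=> w; rewrite [x t w]devE; ring.
refine (eq_pastm e _); apply: pastmB; first by apply: past_dev; lia.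
by apply: pastmD; apply: pastmZ; apply: past_dev; lia.
Qed.

Lemma Ex_innovM t Y : pastm z t Y -> mom P Y -> Ex P (fun w => a t w * Y w) = 0.
Proof.
move=> pY mY.
rewrite (@Ex_past_indep _ _ _ _ z a (ar2_causal hz) t id Y)//.
- by rewrite [X in X * _]Ex_innov mul0r.
- exact: mom_innov.
Qed.

(** * Innovation variance, autocovariances and the Yule-Walker equations *)

Definition innov_var : R := Ex P (fun w => a 0 w ^+ 2).

Lemma Ex_innov2 t : Ex P (fun w => a t w ^+ 2) = innov_var.
Proof. by apply: Ex_normal_sqr; exact: (ar2_innovations_normal hz). Qed.

Lemma innov_var_gt0 : 0 < innov_var.
Proof.
apply: (Ex_normal_sqr_gt0 (s := sigma)); first exact: mom_innov.
exact: (ar2_innovations_normal hz).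
Qed.

Lemma Ex_innov2M t Y : pastm z t Y -> mom P Y ->
  Ex P (fun w => a t w ^+ 2 * Y w) = innov_var * Ex P Y.
Proof.
move=> pY mY.
rewrite (@Ex_past_indep _ _ _ _ z a (ar2_causal hz) t (fun y => y ^+ 2) Y)//.
- by congr (_ * _); exact: Ex_innov2.
- exact: (momX 2 (mom_innov t)).
Qed.

Definition acov (h : nat) : R := Ex P (fun w => x 0 w * x (- h%:Z) w).

Lemma acovE t h : Ex P (fun w => x t w * x (t - h%:Z) w) = acov h.
Proof.
have [_ _ zst] := ar2_stationary hz.
have := zst 0 (- h%:Z) t; rewrite add0r [- _ + t]addrC !covariance_dev.
by rewrite !integral_Ex; [move=> [->]|apply: momM; exact: mom_dev..].
Qed.

Lemma acovE2 s t h : s = t - h%:Z -> Ex P (fun w => x t w * x s w) = acov h.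
Proof. by move=> ->; exact: acovE. Qed.

Lemma acovE3 s t h : s = t - h%:Z -> Ex P (fun w => x s w * x t w) = acov h.
Proof. by move=> /acovE2 <-; apply: eq_Ex => w; rewrite mulrC. Qed.

Lemma momMdev s t : mom P (fun w => x s w * x t w).
Proof. by apply: momM; exact: mom_dev. Qed.

Lemma yw1 : acov 1 = rho * acov 0.
Proof.
have h : acov 1 = phi1 * acov 0 + phi2 * acov 1.
  rewrite -{1}(acovE 0 1).
  rewrite (@eq_Ex _ _ _ P _ (fun w => phi1 * (x (-1) w * x (-1) w) +
    (phi2 * (x (-2) w * x (-1) w) + a 0 w * x (-1) w))); last first.
    by move=> w; rewrite devE !sub0r; ring.
  rewrite ExD; [|by apply: momZ; exact: momMdev|]; last first.
    apply: momD; first by apply: momZ; exact: momMdev.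
    by apply: momM; [exact: mom_innov|exact: mom_dev].
  rewrite ExD; [|by apply: momZ; exact: momMdev|]; last first.
    by apply: momM; [exact: mom_innov|exact: mom_dev].
  rewrite !ExZ; try exact: momMdev.
  rewrite Ex_innovM ?addr0; [|exact: past_dev|exact: mom_dev].
  by rewrite (@acovE2 (-1) (-1) 0 ltac:(lia)) (@acovE3 (-2) (-1) 1 ltac:(lia)).
have p := one_sub_phi2_gt0.
rewrite /rho -mulrA [_^-1 * _]mulrC mulrA; apply/eqP.
rewrite eq_sym -subr_eq0; apply/eqP.
have -> : phi1 * acov 0 = (1 - phi2) * acov 1 by rewrite mulrBl mul1r {1}h; ring.
by field; rewrite gt_eqF.
Qed.

Lemma yw2 : acov 2 = phi1 * acov 1 + phi2 * acov 0.
Proof.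
rewrite -(acovE 0 2).
rewrite (@eq_Ex _ _ _ P _ (fun w => phi1 * (x (-1) w * x (-2) w) +
  (phi2 * (x (-2) w * x (-2) w) + a 0 w * x (-2) w))); last first.
  by move=> w; rewrite devE !sub0r; ring.
rewrite ExD; [|by apply: momZ; exact: momMdev|]; last first.
  apply: momD; first by apply: momZ; exact: momMdev.
  by apply: momM; [exact: mom_innov|exact: mom_dev].
rewrite ExD; [|by apply: momZ; exact: momMdev|]; last first.
  by apply: momM; [exact: mom_innov|exact: mom_dev].
rewrite !ExZ; try exact: momMdev.
rewrite Ex_innovM ?addr0; [|exact: past_dev|exact: mom_dev].
by rewrite (@acovE2 (-2) (-2) 0 ltac:(lia)) (@acovE2 (-2) (-1) 1 ltac:(lia)).
Qed.

Lemma yw0 : acov 0 = phi1 * acov 1 + phi2 * acov 2 + innov_var.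
Proof.
rewrite -{1}(acovE 0 0).
rewrite (@eq_Ex _ _ _ P _ (fun w => phi1 * (x (-1) w * x 0 w) +
  (phi2 * (x (-2) w * x 0 w) + (a 0 w ^+ 2 +
   a 0 w * (phi1 * x (-1) w + phi2 * x (-2) w))))); last first.
  by move=> w; rewrite subr0 {1}[x 0 w]devE !sub0r expr2 [x 0 w]devE !sub0r; ring.
have m1 : mom P (fun w => phi1 * x (-1) w + phi2 * x (-2) w).
  by apply: momD; apply: momZ; exact: mom_dev.
have m2 : mom P (fun w => a 0 w * (phi1 * x (-1) w + phi2 * x (-2) w)).
  by apply: momM => //; exact: mom_innov.
have m3 : mom P (fun w => a 0 w ^+ 2) by apply: momX; exact: mom_innov.
rewrite ExD; [|by apply: momZ; exact: momMdev|]; last first.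
  by apply: momD; [apply: momZ; exact: momMdev|exact: momD].
rewrite ExD; [|by apply: momZ; exact: momMdev|exact: momD].
rewrite ExD// !ExZ; try exact: momMdev.
rewrite Ex_innovM ?addr0//; last first.
  by apply: pastmD; apply: pastmZ; exact: past_dev.
by rewrite (@acovE3 (-1) 0 1 ltac:(lia)) (@acovE3 (-2) 0 2 ltac:(lia)) addrA.
Qed.

(** The Durbin-Levinson product: each partial autocorrelation reduces the prediction error variance
    by one minus its square. *)
Lemma innov_varE : innov_var = acov 0 * (1 - rho ^+ 2) * (1 - phi2 ^+ 2).
Proof.
have -> : innov_var = acov 0 - phi1 * acov 1 - phi2 * acov 2 by rewrite {1}yw0; ring.
by rewrite yw2 yw1 phi1E; ring.
Qed.

Lemma acov0_gt0 : 0 < acov 0.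
Proof.
have := innov_var_gt0; rewrite innov_varE -mulrA pmulr_lgt0//.
have := rho_lt1; have := hphi2; rewrite !ltr_norml => /andP[? ?] /andP[? ?].
by rewrite mulr_gt0//; nra.
Qed.

Let phi2n : 1 - phi2 != 0.
Proof. by rewrite gt_eqF// one_sub_phi2_gt0. Qed.
Let mx t : mom P (x t) := mom_dev t.
Let ma t : mom P (a t) := mom_innov t.

Local Notation s := innov_var.
Local Notation g := acov.

(** * Linearisation of the sample autocovariances in martingale averages *)

Definition dA (t : int) (w : T) : R := a t w ^+ 2 - s.
Definition dU (h : nat) (t : int) (w : T) : R := a t w * x (t - h%:Z) w.
Definition lagprod (h : nat) (t : int) (w : T) : R := x t w * x (t - h%:Z) w.

Lemma bddmom_dA : bddmom P dA.
Proof. by apply: bddmomB; [exact: (bddmomX 2 bddmom_innov)|exact: bddmom1]. Qed.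

Lemma bddmom_dU h : bddmom P (dU h).
Proof. by apply: (bddmomM bddmom_innov); exact: (bddmom_reindex (fun t => t - h%:Z) bddmom_dev). Qed.

Lemma bddmom_lagprod h : bddmom P (lagprod h).
Proof. by apply: (bddmomM bddmom_dev); exact: (bddmom_reindex (fun t => t - h%:Z) bddmom_dev). Qed.

Lemma adapted_dA t : pastm z (t + 1) (dA t).
Proof. by apply: pastmB; [apply: pastmX; exact: (past_innov)|exact: pastm_cst]. Qed.

Lemma adapted_dU h t : pastm z (t + 1) (dU h t).
Proof. by apply: pastmM; [exact: (past_innov)|apply: past_dev; lia]. Qed.

Lemma orth_dA t Y : pastm z t Y -> mom P Y -> Ex P (fun w => dA t w * Y w) = 0.
Proof.
move=> pY mY.
have m2 : mom P (fun w => a t w ^+ 2 * Y w).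
  by apply: momM => //; exact: (momX 2 (ma t)).
rewrite (@eq_Ex _ _ _ P _ (fun w => a t w ^+ 2 * Y w - s * Y w)).
  by rewrite ExB//; [rewrite Ex_innov2M// ExZ// subrr|exact: momZ].
by move=> w; rewrite /dA; ring.
Qed.

Lemma orth_dU h t Y : (0 < h)%N -> pastm z t Y -> mom P Y ->
  Ex P (fun w => dU h t w * Y w) = 0.
Proof.
move=> h0 pY mY.
rewrite (@eq_Ex _ _ _ P _ (fun w => a t w * (x (t - h%:Z) w * Y w))).
  rewrite Ex_innovM//; last exact: momM.
  by apply: pastmM => //; apply: past_dev; lia.
by move=> w; rewrite /dU mulrA.
Qed.

Lemma cross_dU h k t : (0 < h <= k)%N ->
  Ex P (fun w => dU h t w * dU k t w) = s * g (k - h).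
Proof.
move=> hk.
rewrite (@eq_Ex _ _ _ P _ (fun w => a t w ^+ 2 * (x (t - h%:Z) w * x (t - k%:Z) w))).
  rewrite Ex_innov2M; last 2 first.
  - by apply: pastmM; apply: past_dev; lia.
  - exact: momM.
  congr (_ * _); apply: acovE2; lia.
by move=> w; rewrite /dU; ring.
Qed.

(** (a^2 - s) a depends on a_t alone, so its mean, whatever it is, gets multiplied by E x_(t-h) =
    0. *)
Lemma cross_dA_dU h t : (0 < h)%N -> Ex P (fun w => dA t w * dU h t w) = 0.
Proof.
move=> h0.
have mA : mom P (fun w => (a t w ^+ 2 - s) * a t w).
  by apply: momM => //; exact: (bddmom_mom t bddmom_dA).
have -> : Ex P (fun w => dA t w * dU h t w) =
    Ex P (fun w => (a t w ^+ 2 - s) * a t w * x (t - h%:Z) w).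
  by apply: eq_Ex => w; rewrite /dA /dU mulrA.
rewrite (@Ex_past_indep _ _ _ _ z a (ar2_causal hz) t (fun y => (y ^+ 2 - s) * y))//.
- by rewrite Ex_dev mulr0.
- apply: measurable_funM => //; apply: measurable_funB => //.
- by apply: past_dev; lia.
Qed.

Local Notation A := (avg 3 dA).
Local Notation U h := (avg 3 (dU h)).

(** The determinant of the first and third equations below, as a system for p0 and p1 ([detE]).
    Cramer's rule yields [fluct0], where the coefficient of U1 collapses: 2 phi1 (1 - phi2) + 2 phi1
    phi2 = 2 phi1. *)
Definition yw_det : R := (1 + phi2) * (1 - phi2) ^+ 2 * (1 - rho ^+ 2).

Let r2 : 0 < 1 - rho ^+ 2.
Proof.
have := rho_lt1; rewrite ltr_norml => /andP[? ?]; nra.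
Qed.

Lemma yw_det_gt0 : 0 < yw_det.
Proof.
rewrite mulr_gt0// mulr_gt0 ?exprn_gt0 ?one_sub_phi2_gt0//.
by move: hphi2; rewrite ltr_norml => /andP[]; lra.
Qed.

(* To leading order the fluctuations p_h of the sample autocovariances solve the
   perturbed Yule-Walker equations
     (1 - phi2) p1 = phi1 p0 + U1,  p2 = phi1 p1 + phi2 p0 + U2,
     (1 - phi1^2 - phi2^2) p0 - 2 phi1 phi2 p1 = A + 2 phi1 U1 + 2 phi2 U2,
   where A, U1, U2 are averages of martingale differences. *)
Definition fluct0 n w : R := yw_det^-1 * ((1 - phi2) * A n w +
  (2 * phi1 * U 1 n w + (1 - phi2) * (2 * phi2) * U 2 n w)).
Definition fluct1 n w : R := rho * fluct0 n w + (1 - phi2)^-1 * U 1 n w.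
Definition fluct2 n w : R :=
  phi1 * fluct1 n w + (phi2 * fluct0 n w + U 2 n w).
Definition fluct (h : nat) : nat -> T -> R :=
  match h with 0 => fluct0 | 1 => fluct1 | _ => fluct2 end.

Let O1A : momO P 1 A.
Proof. exact: momO1_avg bddmom_dA adapted_dA orth_dA. Qed.

Let O1U h : (0 < h)%N -> momO P 1 (U h).
Proof.
move=> h0; apply: (momO1_avg (bddmom_dU h) (adapted_dU h)) => t Y.
exact: orth_dU.
Qed.

Let meanA : meanO P A 0.
Proof. exact: meanO_avg bddmom_dA orth_dA. Qed.

Let meanU h : (0 < h)%N -> meanO P (U h) 0.
Proof.
by move=> h0; apply: (meanO_avg (bddmom_dU h)) => t Y; exact: orth_dU.
Qed.

Lemma meanO_AU h : (0 < h)%N -> meanO P (fun n w => A n w * U h n w) 0.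
Proof.
move=> h0; apply: (meanO_avgM bddmom_dA adapted_dA orth_dA (bddmom_dU h) (adapted_dU h)).
- by move=> t Y; exact: orth_dU.
- by move=> t; exact: cross_dA_dU.
Qed.

Lemma meanO_UU h k : (0 < h <= k)%N ->
  meanO P (fun n w => U h n w * U k n w) (s * g (k - h)).
Proof.
move=> hk; have /andP[h0 hlk] := hk; have k0 : (0 < k)%N by lia.
apply: (meanO_avgM (bddmom_dU h) (adapted_dU h) _ (bddmom_dU k) (adapted_dU k)).
- by move=> t Y; exact: orth_dU.
- by move=> t Y; exact: orth_dU.
- by move=> t; exact: cross_dU.
Qed.

Lemma momO1_fluct h : momO P 1 (fluct h).
Proof.
have O0 : momO P 1 fluct0.
  apply: momOZ; apply: momOD; first exact: momOZ.
  by apply: momOD; apply: momOZ; exact: O1U.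
have O1 : momO P 1 fluct1 by apply: momOD; apply: momOZ => //; exact: O1U.
case: h => [|[|h]] //=; apply: momOD; first exact: momOZ.
by apply: momOD; [exact: momOZ|exact: O1U].
Qed.

Lemma meanO_fluct h : meanO P (fluct h) 0.
Proof.
have M0 : meanO P fluct0 0.
  have := meanO_Z yw_det^-1 (meanO_D (meanO_Z (1 - phi2) meanA)
   (meanO_D (meanO_Z (2 * phi1) (meanU (h := 1) isT))
     (meanO_Z ((1 - phi2) * (2 * phi2)) (meanU (h := 2) isT)))).
  by rewrite !(mulr0, addr0).
have M1 : meanO P fluct1 0.
  have := meanO_D (meanO_Z rho M0) (meanO_Z (1 - phi2)^-1 (meanU (h := 1) isT)).
  by rewrite !(mulr0, addr0).
case: h => [|[|h]] //=.
have := meanO_D (meanO_Z phi1 M1) (meanO_D (meanO_Z phi2 M0) (meanU (h := 2) isT)).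
by rewrite !(mulr0, addr0).
Qed.

Let meanUU11 : meanO P (fun n w => U 1 n w * U 1 n w) (s * g 0).
Proof. exact: meanO_UU. Qed.
Let meanUU12 : meanO P (fun n w => U 1 n w * U 2 n w) (s * g 1).
Proof. exact: meanO_UU. Qed.
Let meanUU22 : meanO P (fun n w => U 2 n w * U 2 n w) (s * g 0).
Proof. exact: meanO_UU. Qed.

Let fd : [/\ 1 - phi2 != 0, 1 + phi2 != 0 & 1 - rho ^+ 2 != 0].
Proof.
split; rewrite gt_eqF ?one_sub_phi2_gt0//.
by move: hphi2; rewrite ltr_norml => /andP[]; lra.
Qed.

(** By [innov_varE], s / yw_det = g0 / (1 - phi2); this is why the means of the four products p_i
    U_j are polynomials in g0, rho and phi2. *)
Lemma meanO_fluct0_U1 :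
  meanO P (fun n w => fluct0 n w * U 1 n w) (2 * rho * g 0 ^+ 2 * (1 + phi2)).
Proof.
have [f1 f2 f3] := fd.
have := meanO_Z yw_det^-1 (meanO_D (meanO_Z (1 - phi2) (meanO_AU (h := 1) isT))
   (meanO_D (meanO_Z (2 * phi1) meanUU11)
     (meanO_Z ((1 - phi2) * (2 * phi2)) meanUU12))).
rewrite [X in meanO _ _ X](_ : _ = 2 * rho * g 0 ^+ 2 * (1 + phi2)).
  by apply: eq_meanO => n w; rewrite /fluct0; ring.
by rewrite /yw_det yw1 innov_varE phi1E; field; rewrite f1 f2 f3.
Qed.

Lemma meanO_fluct0_U2 :
  meanO P (fun n w => fluct0 n w * U 2 n w) (2 * g 0 ^+ 2 * (rho ^+ 2 + phi2)).
Proof.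
have [f1 f2 f3] := fd.
have := meanO_Z yw_det^-1 (meanO_D (meanO_Z (1 - phi2) (meanO_AU (h := 2) isT))
   (meanO_D (meanO_Z (2 * phi1) meanUU12)
     (meanO_Z ((1 - phi2) * (2 * phi2)) meanUU22))).
rewrite [X in meanO _ _ X](_ : _ = 2 * g 0 ^+ 2 * (rho ^+ 2 + phi2)).
  by apply: eq_meanO => n w; rewrite /fluct0; ring.
by rewrite /yw_det yw1 innov_varE phi1E; field; rewrite f1 f2 f3.
Qed.

Lemma meanO_fluct1_U1 : meanO P (fun n w => fluct1 n w * U 1 n w)
  (g 0 ^+ 2 * (1 + phi2) * (1 + rho ^+ 2)).
Proof.
have [f1 f2 f3] := fd.
have := meanO_D (meanO_Z rho meanO_fluct0_U1) (meanO_Z (1 - phi2)^-1 meanUU11).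
rewrite [X in meanO _ _ X](_ : _ = g 0 ^+ 2 * (1 + phi2) * (1 + rho ^+ 2)).
  by apply: eq_meanO => n w; rewrite /fluct1; ring.
by rewrite innov_varE; field; rewrite f1.
Qed.

Lemma meanO_fluct1_U2 : meanO P (fun n w => fluct1 n w * U 2 n w)
  (g 0 ^+ 2 * rho * (1 + rho ^+ 2 + 3 * phi2 - rho ^+ 2 * phi2)).
Proof.
have [f1 f2 f3] := fd.
have := meanO_D (meanO_Z rho meanO_fluct0_U2) (meanO_Z (1 - phi2)^-1 meanUU12).
rewrite [X in meanO _ _ X](_ : _ =
    g 0 ^+ 2 * rho * (1 + rho ^+ 2 + 3 * phi2 - rho ^+ 2 * phi2)).
  by apply: eq_meanO => n w; rewrite /fluct1; ring.
by rewrite yw1 innov_varE; field; rewrite f1.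
Qed.

Local Notation L h j := (avg 3 (fun t => lagprod h (t - j%:Z))).

Let UE1 n w : U 1 n w = L 1 0 n w - (phi1 * L 0 1 n w + phi2 * L 1 1 n w).
Proof.
apply/eqP; rewrite eq_sym subr_eq -!avgZ -!avgD; apply/eqP.
apply: eq_avg => t v; rewrite /dU /lagprod subr0.
have -> : t - 1 - 0 = t - 1 :> int by lia.
have -> : t - 1 - 1 = t - 2 :> int by lia.
by rewrite {1}(devE t); ring.
Qed.

Let UE2 n w : U 2 n w = L 2 0 n w - (phi1 * L 1 1 n w + phi2 * L 0 2 n w).
Proof.
apply/eqP; rewrite eq_sym subr_eq -!avgZ -!avgD; apply/eqP.
apply: eq_avg => t v; rewrite /dU /lagprod subr0.
have -> : t - 2 - 0 = t - 2 :> int by lia.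
have -> : t - 1 - 1 = t - 2 :> int by lia.
by rewrite {1}(devE t); ring.
Qed.

Let AE n w : A n w + avg 3 (fun _ _ => s) n w = L 0 0 n w -
  (phi1 ^+ 2 * L 0 1 n w + (phi2 ^+ 2 * L 0 2 n w + (2 * phi1 * phi2 * L 1 1 n w +
  (2 * phi1 * U 1 n w + 2 * phi2 * U 2 n w)))).
Proof.
apply/eqP; rewrite eq_sym subr_eq -!avgZ -!avgD; apply/eqP.
apply: eq_avg => t v; rewrite /dU /dA /lagprod !subr0.
have -> : t - 1 - 1 = t - 2 :> int by lia.
by rewrite (devE t); ring.
Qed.

Let O2L h j : momO P 2 (fun n w => L h j n w - avg 3 (lagprod h) n w).
Proof. by apply: momO_avg_lag => //; exact: bddmom_lagprod. Qed.

Let O2s : momO P 2 (fun n w => avg 3 (fun _ (_ : T) => s) n w - s).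
Proof.
have := @momO2_inv _ _ _ P (fun _ _ => - (2 * s)) (bddmom1 P nat (- (2 * s))).
apply: eq_momO => n w; rewrite /avg sumr_const_nat -(mulr_natl s).
have -> : (n.+4 - 3)%N = n.+1 by lia.
have -> : n.+1%:R = n.+3%:R - 2 :> R by rewrite -[n.+3]addn2 natrD addrK.
have : n.+3%:R != 0 :> R by rewrite pnatr_eq0.
by move: n.+3%:R => N N0; field.
Qed.

Let L0 h n w : L h 0 n w = avg 3 (lagprod h) n w.
Proof. by apply: eq_avg => t v; rewrite subr0. Qed.

Let q h n w : R := avg 3 (lagprod h) n w - g h.

Let det0 : yw_det != 0.
Proof. by rewrite gt_eqF// yw_det_gt0. Qed.

Let detE : yw_det =
  (1 - phi2) * (1 - phi1 ^+ 2 - phi2 ^+ 2) - 2 * phi1 ^+ 2 * phi2.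
Proof. by rewrite /yw_det phi1E; ring. Qed.

Let h0 : (1 - phi2) * g 1 - phi1 * g 0 = 0.
Proof. by rewrite yw1 phi1E; ring. Qed.

Let E1 : momO P 2 (fun n w => U 1 n w - ((1 - phi2) * q 1 n w - phi1 * q 0 n w)).
Proof.
have := momOB (momOZ (- phi1) (O2L 0 1)) (momOZ phi2 (O2L 1 1)).
(* The Yule-Walker relation enters as an added zero, so that [ring] can see it. *)
apply: eq_momO => n w; rewrite UE1 L0 /q -[LHS]addr0 -h0; ring.
Qed.

Let E2 : momO P 2 (fun n w => U 2 n w - (q 2 n w - phi1 * q 1 n w - phi2 * q 0 n w)).
Proof.
have := momOB (momOZ (- phi1) (O2L 1 1)) (momOZ phi2 (O2L 0 2)).
apply: eq_momO => n w; rewrite UE2 L0 /q yw2; ring.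
Qed.

Let E0 : momO P 2 (fun n w => A n w - ((1 - phi1 ^+ 2 - phi2 ^+ 2) * q 0 n w -
  2 * phi1 * phi2 * q 1 n w - 2 * phi1 * U 1 n w - 2 * phi2 * U 2 n w)).
Proof.
have := momOB (momOB (momOZ (- phi1 ^+ 2) (O2L 0 1)) (momOZ (phi2 ^+ 2) (O2L 0 2)))
  (momOD (momOZ (2 * phi1 * phi2) (O2L 1 1)) O2s).
apply: eq_momO => n w.
have -> : A n.+3 w = A n.+3 w + avg 3 (fun _ _ => s) n.+3 w
  - avg 3 (fun _ _ => s) n.+3 w by rewrite addrK.
rewrite AE L0 /q.
have -> : s = g 0 - phi1 * g 1 - phi2 * g 2 by rewrite {1}yw0; ring.
rewrite yw2 -[LHS]addr0 -[X in _ + X = _](mulr0 phi1) -h0; ring.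
Qed.

Lemma lagprod_lead h : (h <= 2)%N ->
  momO P 2 (fun n w => avg 3 (lagprod h) n w - g h - fluct h n w).
Proof.
have F0 : momO P 2 (fun n w => q 0 n w - fluct0 n w).
  have := momOZ (- (yw_det)^-1)
    (momOD (momOZ (1 - phi2) E0) (momOZ (2 * phi1 * phi2) E1)).
  apply: eq_momO => n w; rewrite /fluct0.
  have e : q 0 n.+3 w = (yw_det)^-1 *
     (((1 - phi2) * (1 - phi1 ^+ 2 - phi2 ^+ 2) - 2 * phi1 ^+ 2 * phi2) * q 0 n.+3 w).
    by rewrite -detE mulKf.
  by rewrite [X in _ = X - _]e; ring.
have F1 : momO P 2 (fun n w => q 1 n w - fluct1 n w).
  have := momOB (momOZ rho F0) (momOZ (1 - phi2)^-1 E1).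
  apply: eq_momO => n w; rewrite /fluct1 phi1E; field.
  exact: phi2n.
case: h => [|[|[|//]]] _ //=.
have := momOB (momOD (momOZ phi1 F1) (momOZ phi2 F0)) E2.
by apply: eq_momO => n w; rewrite /fluct2 /q; ring.
Qed.

(** * The sample mean and the centred sample autocovariances *)

Definition xbar (n : nat) (w : T) : R := avg 1 x n w.

Local Notation abar := (avg 3 (fun t => a t : T -> R)).

Let phi12n : 1 - phi1 - phi2 != 0.
Proof. by rewrite gt_eqF//; move: hsum => h; rewrite -addrA -opprD subr_gt0. Qed.

(** Average the AR(2) equation: the averages of x_t, x_(t-1) and x_(t-2) agree up to end effects. *)
Lemma xbar_lead :
  momO P 2 (fun n w => xbar n w - (1 - phi1 - phi2)^-1 * abar n w).
Proof.
have h1 := @momO_avg_start3 _ _ _ P 1 x isT bddmom_dev.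
have l1 := @momO_avg_lag _ _ _ P 3 1 x isT bddmom_dev.
have l2 := @momO_avg_lag _ _ _ P 3 2 x isT bddmom_dev.
have aE n w : abar n w + phi1 * avg 3 (fun t => x (t - 1)) n w +
    phi2 * avg 3 (fun t => x (t - 2)) n w = avg 3 x n w.
  rewrite -!avgZ -!avgD; apply: eq_avg => t v.
  by rewrite [in RHS](devE t); ring.
have := momOD h1 (momOZ (1 - phi1 - phi2)^-1
  (momOD (momOZ phi1 l1) (momOZ phi2 l2))).
apply: eq_momO => n w; rewrite /xbar.
have -> : abar n.+3 w = avg 3 x n.+3 w - phi1 * avg 3 (fun t => x (t - 1)) n.+3 w -
    phi2 * avg 3 (fun t => x (t - 2)) n.+3 w by rewrite -[X in X - _ - _]aE; ring.
by field.
Qed.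

Lemma momO1_abar : momO P 1 abar.
Proof. exact: momO1_avg bddmom_innov past_innov Ex_innovM. Qed.

Lemma momO1_xbar : momO P 1 xbar.
Proof.
have := momOD (@momO_le _ _ _ P 1 2 _ isT xbar_lead)
  (momOZ (1 - phi1 - phi2)^-1 momO1_abar).
by apply: eq_momO => n w; ring.
Qed.

Lemma meanO_xbar2 : meanO P (fun n w => xbar n w * xbar n w)
  (s / (1 - phi1 - phi2) ^+ 2).
Proof.
have h := meanO_avgM bddmom_innov past_innov Ex_innovM bddmom_innov past_innov Ex_innovM (fun t => _).
have {}h : meanO P (fun n w => abar n w * abar n w) s.
  apply: h => t; rewrite -(Ex_innov2 t).
  by apply: eq_Ex => w; rewrite expr2.
have k := momOD (momOM xbar_lead momO1_xbar)
  (momOZ (1 - phi1 - phi2)^-1 (momOM momO1_abar xbar_lead)).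
have := meanO_D (meanO_Z ((1 - phi1 - phi2) ^+ 2)^-1 h) (meanO_momO k).
rewrite addr0 [_ * s]mulrC.
by apply: eq_meanO => n w; field.
Qed.

Definition sample_acov (m k i n : nat) (w : T) : R := Sbar (fun t => z t w) n m k i.

Lemma sample_acovC m k i n w : sample_acov m k i n w = sample_acov k m i n w.
Proof. by rewrite /sample_acov /Sbar; under eq_bigr do rewrite mulrC. Qed.

(** The last coefficient is the proportion of terms present: [Sbar] divides by the sample size but
    sums i - 1 terms fewer. *)
Lemma sample_acovE m h i n w : (0 < i <= 3)%N ->
  sample_acov m (m + h) i n.+3 w = avg i (fun t => lagprod h (t - m%:Z)) n.+3 w
    - xbar n.+3 w * avg i (fun t => x (t - m%:Z)) n.+3 w
    - xbar n.+3 w * avg i (fun t => x (t - (m + h)%:Z)) n.+3 w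
    + (1 - (i.-1)%:R / n.+3%:R) * (xbar n.+3 w * xbar n.+3 w).
Proof.
move=> i3; have N0 : n.+3%:R != 0 :> R by rewrite pnatr_eq0.
have sm : sample_mean (fun t => z t w) n.+3 = xbar n.+3 w + mu.
  rewrite /sample_mean /xbar /avg.
  under eq_bigr do rewrite obsE.
  by rewrite big_split /= sumr_const_nat subn1 /= mulrDr -[mu *+ _]mulr_natl mulKf.
have -> : 1 - (i.-1)%:R / n.+3%:R = n.+3%:R^-1 * (n.+4 - i)%:R :> R.
  have -> : (n.+4 - i = n.+3 - i.-1)%N by lia.
  by rewrite natrB; [field|lia].
have cE (c : R) : n.+3%:R^-1 * (n.+4 - i)%:R * c = avg i (fun _ (_ : T) => c) n.+3 w.
  by rewrite /avg sumr_const_nat -(mulr_natl c) mulrA.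
move: (xbar n.+3 w) sm => X sm; rewrite cE -!mulNr -!avgZ -!avgD /sample_acov /Sbar /avg; congr (_ * _).
apply: eq_bigr => t _; rewrite sm !obsE /lagprod.
have -> : t%:Z - m%:Z - h%:Z = t%:Z - (m + h)%:Z :> int by lia.
ring.
Qed.

(** Defined as everything left over, so the third-order remainder in [exp3_sample_acov] is 0 and
    only the mean of this term has to be found. *)
Definition sample_acov_rem (m h i n : nat) (w : T) : R :=
  sample_acov m (m + h) i n w - g h - fluct h n w.

Let O2i (i : nat) : momO P 2 (fun n (_ : T) => i%:R / n%:R).
Proof.
have := @momO2_inv _ _ _ P (fun _ _ => i%:R) (bddmom1 P nat i%:R).
by apply: eq_momO => n w; rewrite mulrC.
Qed.

(** Each of the two linear terms contributes -xbar^2 and the quadratic one +xbar^2. *)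
Lemma sample_acov_center m h i : (0 < i <= 3)%N ->
  momO P 3 (fun n w => sample_acov m (m + h) i n w -
    avg i (fun t => lagprod h (t - m%:Z)) n w + xbar n w * xbar n w).
Proof.
move=> i3; have i3' : (i <= 3)%N by lia.
have l1 j : momO P 2 (fun n w => avg i (fun t => x (t - j%:Z)) n w - xbar n w).
  have := momOB (@momO_avg_lag _ _ _ P i j x i3' bddmom_dev)
    (@momO_avg_start3 _ _ _ P 1 x isT bddmom_dev).
  by apply: eq_momO => n w; rewrite /xbar; ring.
have k4 := @momO_le _ _ _ P 3 4 _ isT (momOM (O2i i.-1) (momOM momO1_xbar momO1_xbar)).
have k1 := momOM momO1_xbar (l1 m).
have k2 := momOM momO1_xbar (l1 (m + h)%N).
have := momON (momOD (momOD k1 k2) k4).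
by apply: eq_momO => n w; rewrite sample_acovE//; ring.
Qed.

Lemma momO2_sample_acov_rem m h i : (h <= 2)%N -> (0 < i <= 3)%N -> momO P 2 (sample_acov_rem m h i).
Proof.
move=> h2 i3; have i3' : (i <= 3)%N by lia.
have k1 := @momO_le _ _ _ P 2 3 _ isT (sample_acov_center m h i3).
have k2 := momOM momO1_xbar momO1_xbar.
have k3 := lagprod_lead h2.
have k4 := @momO_avg_lag _ _ _ P i m _ i3' (bddmom_lagprod h).
have := momOB (momOD k1 (momOD k3 k4)) k2.
by apply: eq_momO => n w; rewrite /sample_acov_rem; ring.
Qed.

Lemma exp3_sample_acov m h i : (h <= 2)%N -> (0 < i <= 3)%N ->
  exp3 P (sample_acov m (m + h) i) (g h) (fluct h) (sample_acov_rem m h i).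
Proof.
move=> h2 i3; split.
- exact: momO1_fluct.
- exact: momO2_sample_acov_rem.
have z3 : momO P 3 (fun _ (_ : T) => 0).
  by apply: (@momO_det _ _ _ _ _ (fun=> 0) 0) => n; rewrite normr0 mulr0.
by apply: eq_momO z3 => n w; rewrite /sample_acov_rem; ring.
Qed.

(** The i - 1 missing terms cost (i - 1) g_h, and centring at the sample mean costs n E(xbar^2) in
    the limit. *)
Lemma meanO_sample_acov_rem m h i : (h <= 2)%N -> (0 < i <= 3)%N ->
  meanO P (sample_acov_rem m h i) (- ((i.-1)%:R * g h) - s / (1 - phi1 - phi2) ^+ 2).
Proof.
move=> h2 i3.
have k1 : meanO P (fun n w => avg i (fun t => lagprod h (t - m%:Z)) n w - g h)
    (- ((i.-1)%:R * g h)).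
  have bl : bddmom P (fun t => lagprod h (t - m%:Z)).
    exact: (bddmom_reindex (fun t => t - m%:Z) (bddmom_lagprod h)).
  apply: (@meanO_Ex _ _ _ _ _ _ 0) => n.
    by apply: momB; [exact: avg_mom|exact: mom_cst].
  rewrite ExB; [|exact: avg_mom|exact: mom_cst].
  rewrite Ex_cst (@Ex_avg _ _ _ _ _ _ _ (g h))//; [|lia|]; last first.
    by move=> t; apply: acovE.
  have -> : (n.+4 - i = n.+3 - i.-1)%N by lia.
  rewrite natrB; last by lia.
  have N0 : n.+3%:R != 0 :> R by rewrite pnatr_eq0.
  rewrite mul0r normr_le0; apply/eqP; move: N0.
  by move: n.+3%:R i.-1%:R => N j N0; field.
have k2 := meanO_Z (-1) (meanO_fluct h).
have k3 := meanO_Z (-1) meanO_xbar2.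
have k4 := meanO_momO (sample_acov_center m h i3).
have := meanO_D (meanO_D k1 k2) (meanO_D k3 k4).
rewrite mulr0 !addr0 mulN1r.
by apply: eq_meanO => n w; rewrite /sample_acov_rem; ring.
Qed.

(** * Second-order expansion of the Burg estimators *)

Local Notation p0 := fluct0.
Local Notation p1 := fluct1.
Local Notation p2 := fluct2.
Local Notation rem := sample_acov_rem.
Local Notation g0 := (g 0).
Local Notation v := (s / (1 - phi1 - phi2) ^+ 2).
Local Notation path w := (fun t => z t w).

Let S m h i (h2 : (h <= 2)%N) (i3 : (0 < i <= 3)%N) :=
  exp3_sample_acov m h2 i3.
Let MS m h i (h2 : (h <= 2)%N) (i3 : (0 < i <= 3)%N) :=
  meanO_sample_acov_rem m h2 i3.

Let remC n w := rem 0 0 3 n w + rem 2 0 3 n w.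
Let remD n w := rem 0 0 2 n w + rem 1 0 2 n w.
Let remE n w := rem 0 2 3 n w.
Let remF n w := rem 0 1 2 n w.
Let remG n w := rem 1 0 3 n w.
Let remH n w := rem 0 1 3 n w + rem 1 1 3 n w.

Let bC n w := burgC (path w) n.
Let bD n w := burgD (path w) n.
Let bE n w := burgE (path w) n.
Let bF n w := burgF (path w) n.
Let bG n w := burgG (path w) n.
Let bH n w := burgH (path w) n.

Let g2E : g 2 = g0 * (rho ^+ 2 * (1 - phi2) + phi2).
Proof.
rewrite (yw2) yw1.
by rewrite phi1E; ring.
Qed.

Let eC : exp3 P bC (2 * g0) (fun n w => 2 * p0 n w) remC.
Proof.
apply: (eq_exp3 (exp3D (@S 0 0 3 isT isT) (@S 2 0 3 isT isT))) => //.
- by ring.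
- by move=> n w /=; ring.
Qed.

Let eD : exp3 P bD (2 * g0) (fun n w => 2 * p0 n w) remD.
Proof.
apply: (eq_exp3 (exp3D (@S 0 0 2 isT isT) (@S 1 0 2 isT isT))) => //.
- by ring.
- by move=> n w /=; ring.
Qed.

Let eE : exp3 P bE (g0 * (rho ^+ 2 * (1 - phi2) + phi2)) p2 remE.
Proof. by rewrite -g2E; exact: (@S 0 2 3). Qed.

Let eF : exp3 P bF (rho * g0) p1 remF.
Proof. by rewrite -yw1; exact: (@S 0 1 2). Qed.

Let eG : exp3 P bG g0 p0 remG.
Proof. exact: (@S 1 0 3). Qed.

Let eH : exp3 P bH (2 * (rho * g0)) (fun n w => 2 * p1 n w) remH.
Proof.
apply: (eq_exp3 (exp3D (@S 0 1 3 isT isT) (@S 1 1 3 isT isT))) => //.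
- by move=> n w; rewrite [sample_acov 1 _ _ _ _]sample_acovC.
- by rewrite -yw1; ring.
- by move=> n w /=; ring.
Qed.

Let eC2E := exp3D eC (exp3Z (-2) eE).

Local Notation d0 := (8 * g0 ^+ 3 * (1 - rho ^+ 2)).

Let eDen0 := exp3D (exp3M eC (exp3M eD eD))
  (exp3D (exp3Z 8 (exp3M eF (exp3M eF eG))) (exp3Z (-4) (exp3M eF (exp3M eH eD)))).

Let den2 n w : R := 4 * g0 ^+ 2 * remC n w + 8 * g0 ^+ 2 * (1 - rho ^+ 2) * remD n w
  + 8 * rho ^+ 2 * g0 ^+ 2 * remG n w - 8 * rho * g0 ^+ 2 * remH n w
  + 24 * g0 * p0 n w ^+ 2 - 16 * rho * g0 * p0 n w * p1 n w
  - 8 * g0 * p1 n w ^+ 2.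

Let eDen : exp3 P (fun n w => burg_den (path w) n) d0
  (fun n w => 8 * g0 ^+ 2 * ((3 - rho ^+ 2) * p0 n w - 2 * rho * p1 n w)) den2.
Proof.
apply: (eq_exp3 eDen0).
- by move=> n w; rewrite /bC /bD /bF /bG /bH /burg_den; ring.
- by ring.
- by move=> n w; ring.
- by move=> n w; rewrite /den2; ring.
Qed.

(** Reading U1 and U2 back from the fluctuations lets [ring] recognise the first-order numerators as
    combinations of U1 and U2. *)
Let U1E n w : U 1 n w = (1 - phi2) * (p1 n w - rho * p0 n w).
Proof. by rewrite /fluct1; field. Qed.

Let U2E n w : U 2 n w = p2 n w - rho * (1 - phi2) * p1 n w - phi2 * p0 n w.
Proof. by rewrite /fluct2 -phi1E; ring. Qed.

Let num2 n w : R := 8 * g0 * (2 * (p0 n w * U 2 n w) - rho * (p0 n w * U 1 n w)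
   - p1 n w * U 1 n w)
  + g0 ^+ 2 * (8 * remE n w - 4 * phi2 * remC n w
     + 8 * rho ^+ 2 * (1 - phi2) * remG n w - 8 * rho * (1 - phi2) * remH n w).

(** Divided by [d0], the first-order term is (U2 - rho U1) / (g0 (1 - rho^2)), as for least squares:
    a component of the inverse autocovariance matrix applied to (U1, U2). *)
Let eNum2 : exp3 P (fun n w => (burg_phi2 (path w) n - phi2) * burg_den (path w) n) 0
  (fun n w => 8 * g0 ^+ 2 * (U 2 n w - rho * U 1 n w)) num2.
Proof.
apply: (eq_exp3 (exp3D (exp3Z (1 - phi2) eDen) (exp3Z (-1) (exp3M eC2E (exp3M eD eD))))).
- by move=> n w; rewrite burg_phi2_den /bC /bD /bE; ring.
- by ring.
- by move=> n w; rewrite U1E U2E; ring.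
- by move=> n w; rewrite /num2 /den2 U1E U2E; ring.
Qed.

Let num1 n w : R := 8 * g0 * (2 * (p0 n w * U 1 n w) - rho * (p0 n w * U 2 n w)
   - p1 n w * U 2 n w)
  + g0 ^+ 2 * ((1 - phi2) * (1 - rho ^+ 2) * (8 * remF n w - 4 * rho * remD n w)
     + 4 * rho * phi2 * remC n w - 8 * rho * remE n w
     - rho * (1 - phi2) * (8 * rho ^+ 2 * remG n w - 8 * rho * remH n w)).

Let eNum1 : exp3 P (fun n w => (burg_phi1 (path w) n - phi1) * burg_den (path w) n) 0
  (fun n w => 8 * g0 ^+ 2 * (U 1 n w - rho * U 2 n w)) num1.
Proof.
apply: (eq_exp3 (exp3D (exp3Z 2 (exp3M eF (exp3M eD eC2E)))
  (exp3Z (- (rho * (1 - phi2))) eDen))).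
- by move=> n w; rewrite burg_phi1_den /bC /bD /bE /bF phi1E; ring.
- by ring.
- by move=> n w; rewrite U1E U2E; ring.
- by move=> n w; rewrite /num1 /den2 U1E U2E; ring.
Qed.

Let r1 : -1 < rho < 1.
Proof. by have := rho_lt1; rewrite ltr_norml. Qed.
Let g0n : g0 != 0.
Proof. by rewrite gt_eqF// acov0_gt0. Qed.
Let r2n : 1 - rho ^+ 2 != 0.
Proof. by rewrite gt_eqF//; case/andP: r1 => ? ?; nra. Qed.
Let rn : 1 - rho != 0.
Proof. by rewrite gt_eqF// subr_gt0; case/andP: r1. Qed.
Let d0n : d0 != 0.
Proof. by rewrite !mulf_neq0 ?expf_neq0// pnatr_eq0. Qed.

Let vE : v = g0 * (1 + rho) * (1 + phi2) / ((1 - phi2) * (1 - rho)).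
Proof.
have -> : 1 - phi1 - phi2 = (1 - rho) * (1 - phi2).
  by rewrite phi1E; ring.
by rewrite innov_varE; field; rewrite rn phi2n.
Qed.

Let MC : meanO P remC (- (4 * g0) - 2 * v).
Proof.
have := meanO_D (@MS 0 0 3 isT isT) (@MS 2 0 3 isT isT).
by congr (meanO _ _ _); rewrite /=; ring.
Qed.
Let MD : meanO P remD (- (2 * g0) - 2 * v).
Proof.
have := meanO_D (@MS 0 0 2 isT isT) (@MS 1 0 2 isT isT).
by congr (meanO _ _ _); rewrite /=; ring.
Qed.
Let ME : meanO P remE (- (2 * (g0 * (rho ^+ 2 * (1 - phi2) + phi2))) - v).
Proof. by rewrite -g2E; exact: (@MS 0 2 3). Qed.
Let MF : meanO P remF (- (rho * g0) - v).
Proof. by rewrite -yw1 -[g 1]mul1r; exact: (@MS 0 1 2). Qed.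
Let MG : meanO P remG (- (2 * g0) - v).
Proof. exact: (@MS 1 0 3). Qed.
Let MH : meanO P remH (- (4 * (rho * g0)) - 2 * v).
Proof.
have := meanO_D (@MS 0 1 3 isT isT) (@MS 1 1 3 isT isT).
by rewrite yw1; congr (meanO _ _ _); rewrite /=; ring.
Qed.

(** The common factor in N1 D1 / d0^2: numerator and denominator each carry 8 g0^2 at first
    order. *)
Local Notation k := (64 * g0 ^+ 4 / d0 ^+ 2).

Lemma meanO_burg_phi2 :
  meanO P (fun n w => burg_phi2 (path w) n - phi2) (- (2 + 4 * phi2)).
Proof.
have mQ n : measurable_fun setT (fun w => burg_phi2 (path w) n.+3 - phi2).
  by apply: measurable_funB => //; exact: measurable_burg_phi2.
have bQ n w : `|burg_phi2 (path w) n.+3 - phi2| <= 1 + `|phi2|.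
  by apply: (le_trans (ler_normB _ _)); rewrite lerD2r burg_phi2_bound.
have eQ := @exp3_quotient _ _ _ _ (fun n w => burg_phi2 (path w) n - phi2)
  _ _ _ _ _ _ _ _ d0n mQ bQ (fun n w => erefl) eNum2 eDen.
have m1 := meanO_Z (8 * g0 ^+ 2 / d0) (meanO_D (meanU (h := 2) isT) (meanO_Z (- rho) (meanU (h := 1) isT))).
(* The terms in [k] expand -N1 D1 / d0^2; the others are [num2] divided by d0. *)
have m2 := meanO_D
 (meanO_D (meanO_D (meanO_Z (16 * g0 / d0 - k * (3 - rho ^+ 2)) meanO_fluct0_U2)
   (meanO_Z (- 8 * g0 * rho / d0 + k * rho * (3 - rho ^+ 2)) meanO_fluct0_U1))
  (meanO_D (meanO_Z (- 8 * g0 / d0 - k * (2 * rho ^+ 2)) meanO_fluct1_U1)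
   (meanO_Z (k * (2 * rho)) meanO_fluct1_U2)))
 (meanO_D (meanO_D (meanO_Z (8 * g0 ^+ 2 / d0) ME) (meanO_Z (- 4 * phi2 * g0 ^+ 2 / d0) MC))
  (meanO_D (meanO_Z (8 * rho ^+ 2 * (1 - phi2) * g0 ^+ 2 / d0) MG)
   (meanO_Z (- 8 * rho * (1 - phi2) * g0 ^+ 2 / d0) MH))).
rewrite -[X in meanO _ _ X]add0r; apply: (exp3_meanO eQ).
  have -> : 0 = 8 * g0 ^+ 2 / d0 * (0 + - rho * 0) by ring.
  by apply: eq_meanO m1 => n w; field; rewrite r2n g0n.
move: m2; rewrite [X in meanO _ _ X](_ : _ = - (2 + 4 * phi2)).
  by apply: eq_meanO => n w; rewrite /num2; field; rewrite r2n g0n.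
by rewrite vE; field; rewrite rn phi2n r2n g0n.
Qed.

Lemma meanO_burg_phi1 :
  meanO P (fun n w => burg_phi1 (path w) n - phi1) (- (phi2 + phi1 + 1)).
Proof.
have mQ n : measurable_fun setT (fun w => burg_phi1 (path w) n.+3 - phi1).
  by apply: measurable_funB => //; exact: measurable_burg_phi1.
have bQ n w : `|burg_phi1 (path w) n.+3 - phi1| <= 2 + `|phi1|.
  by apply: (le_trans (ler_normB _ _)); rewrite lerD2r burg_phi1_bound.
have eQ := @exp3_quotient _ _ _ _ (fun n w => burg_phi1 (path w) n - phi1)
  _ _ _ _ _ _ _ _ d0n mQ bQ (fun n w => erefl) eNum1 eDen.
have m1 := meanO_Z (8 * g0 ^+ 2 / d0) (meanO_D (meanU (h := 1) isT) (meanO_Z (- rho) (meanU (h := 2) isT))).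
have m2 := meanO_D
 (meanO_D (meanO_D (meanO_Z (16 * g0 / d0 - k * (3 - rho ^+ 2)) meanO_fluct0_U1)
   (meanO_Z (- 8 * g0 * rho / d0 + k * rho * (3 - rho ^+ 2)) meanO_fluct0_U2))
  (meanO_D (meanO_Z (- 8 * g0 / d0 - k * (2 * rho ^+ 2)) meanO_fluct1_U2)
   (meanO_Z (k * (2 * rho)) meanO_fluct1_U1)))
 (meanO_D
   (meanO_D
     (meanO_Z (8 * ((1 - phi2) * (1 - rho ^+ 2)) * g0 ^+ 2 / d0) MF)
     (meanO_Z (- 4 * rho * ((1 - phi2) * (1 - rho ^+ 2)) * g0 ^+ 2 / d0) MD))
   (meanO_D (meanO_D (meanO_Z (- 8 * rho * g0 ^+ 2 / d0) ME)
      (meanO_Z (4 * rho * phi2 * g0 ^+ 2 / d0) MC))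
    (meanO_D (meanO_Z (- 8 * rho ^+ 3 * (1 - phi2) * g0 ^+ 2 / d0) MG)
      (meanO_Z (8 * rho ^+ 2 * (1 - phi2) * g0 ^+ 2 / d0) MH)))).
rewrite -[X in meanO _ _ X]add0r; apply: (exp3_meanO eQ).
  have -> : 0 = 8 * g0 ^+ 2 / d0 * (0 + - rho * 0) by ring.
  by apply: eq_meanO m1 => n w; field; rewrite r2n g0n.
have -> : - (phi2 + phi1 + 1) = - (phi2 + rho * (1 - phi2) + 1) by rewrite -phi1E.
move: m2; rewrite [X in meanO _ _ X](_ : _ = - (phi2 + rho * (1 - phi2) + 1)).
  by apply: eq_meanO => n w; rewrite /num1; field; rewrite r2n g0n.
by rewrite vE; field; rewrite rn phi2n r2n g0n.
Qed.

End ar2.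

Theorem mainTheorem2 (d : measure_display) (T : measurableType d)
    (R : realType) (P : probability T R)
    (phi1 phi2 mu sigma : R) (a z : int -> {RV P >-> R})
    (hphi2 : `|phi2| < 1) (hsum : phi1 + phi2 < 1) (hdiff : phi2 - phi1 < 1)
    (hsigma : 0 < sigma) (hz : gaussian_AR2 phi1 phi2 mu sigma a z) :
  exists r1 r2 : nat -> R,
    [/\ r1 =o_\oo (fun n : nat => n%:R^-1 : R),
        r2 =o_\oo (fun n : nat => n%:R^-1 : R),
        \forall n \near \oo,
          'E_P[(fun w => burg_phi1 (fun t => z t w) n - phi1)%R]%E =
          (- ((phi2 + phi1 + 1) / n%:R) + r1 n)%:E &
        \forall n \near \oo,
          'E_P[(fun w => burg_phi2 (fun t => z t w) n - phi2)%R]%E =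
          (- ((2 + 4 * phi2) / n%:R) + r2 n)%:E].
Proof.
have [r1 [lo1 h1]] := meanO_expectation
  (meanO_burg_phi1 hphi2 hsum hdiff hsigma hz).
have [r2 [lo2 h2]] := meanO_expectation
  (meanO_burg_phi2 hphi2 hsum hdiff hsigma hz).
exists r1, r2; split=> //.
- by apply: filterS h1 => n ->; rewrite mulNr.
- by apply: filterS h2 => n ->; rewrite mulNr.
Qed.
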